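(* Let $\mathcal{Y}$ be a finite set and let $(\nu_n,\pi_n)\in\mathcal{W}_n(\mathcal{Y})\times\tilde{\mathcal{W}}_n(\mathcal{Y}\times\mathcal{Y})$ be a sequence converging to some $(\nu,\pi)\in\mathcal{W}(\mathcal{Y})\times\tilde{\mathcal{W}}_*(\mathcal{Y}\times\mathcal{Y})$ with $\nu(a)>0$ for all $a\in\mathcal{Y}$. Then the law of the empirical occupancy measure $M_{\tilde Y}$ under the random allocation model $\tilde{\mathbb{P}}_{(\nu_n,\pi_n)}$ is exponentially equivalent to the law of the empirical neighbourhood distribution $M_Y$ under the conditional symbolled random graph law $\mathbb{P}_{(\nu_n,\pi_n)}$.
   Context: Notation. $\mathbb{N}=\{0,1,2,\dots\}$. $\mathcal{W}(\mathcal{X})$ is the set of probability measures on a finite or countable set $\mathcal{X}$, and $\tilde{\mathcal{W}}(\mathcal{X})$ the set of finite measures, both with the weak topology; $\tilde{\mathcal{W}}_*(\mathcal{Y}\times\mathcal{Y})$ is the set of symmetric finite measures on $\mathcal{Y}\times\mathcal{Y}$. Further $$\mathcal{W}_n(\mathcal{Y})=\{\nu\in\mathcal{W}(\mathcal{Y}): n\nu(b)\in\mathbb{N}\ \forall b\in\mathcal{Y}\},$$ $$\tilde{\mathcal{W}}_n(\mathcal{Y}\times\mathcal{Y})=\Big\{\pi\in\tilde{\mathcal{W}}_*(\mathcal{Y}\times\mathcal{Y}): \tfrac{n}{1+\mathbf{1}\{a=b\}}\pi(b,a)\in\mathbb{N}\ \forall a,b\in\mathcal{Y}\Big\}.$$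 Conditional symbolled random graph $\mathbb{P}_{(\nu_n,\pi_n)}$. The vertex set is $\mathcal{V}=\{1,\dots,n\}$. Symbols $Y(v)\in\mathcal{Y}$ are assigned to the vertices by drawing without replacement from a pool of $n$ symbols containing each $a\in\mathcal{Y}$ exactly $n\nu_n(a)$ times. Then, for each unordered pair $\{a,b\}$ of symbols, exactly $m_n(b,a)$ edges are created by drawing without replacement (uniformly) from the collection of potential edges linking vertices of symbol $a$ with vertices of symbol $b$, where $m_n(b,a)=n\pi_n(b,a)$ if $a\ne b$ and $m_n(b,a)=\frac n2\pi_n(b,a)$ if $a=b$. (This is the law of the symbolled random graph, with i.i.d. vertex symbols and conditionally independent edges with symbol-dependent probabilities, conditioned on having empirical symbol distribution $\nu_n$ and empirical pair distribution $\pi_n$.) The empirical neighbourhood distribution is $$M_Y(a,l)=\frac1n\sum_{u\in\mathcal{V}}\delta_{(Y(u),\mathcal{L}(u))}(a,l),\qquad (a,l)\in\mathcal{Y}\times\mathbb{N}^{\mathcal{Y}},$$ where $\mathcal{L}(u)=(\ell^u(b))_{b\in\mathcal{Y}}$ and $\ell^u(b)$ is the number of vertices of symbol $b$ linked to $u$. Random allocation model $\tilde{\mathbb{P}}_{(\nu_n,\pi_n)}$. The bins $\mathcal{V}=\{1,\dots,n\}$ are given symbols $\tilde Y(v)$ by drawing without replacement from the pool containing each $a\in\mathcal{Y}$ exactly $n\nu_n(a)$ times. Then, for each ordered pair $(b,a)\in\mathcal{Y}\times\mathcal{Y}$ independently, $n\pi_n(b,a)$ balls of symbol $b$ are placed independently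 and uniformly at random into the $n\nu_n(a)$ bins of symbol $a$. The empirical occupancy measure is $$M_{\tilde Y}(a,l)=\frac1n\sum_{u\in\mathcal{V}}\delta_{(\tilde Y(u),\tilde{\mathcal{L}}(u))}(a,l),\qquad (a,l)\in\mathcal{Y}\times\mathbb{N}^{\mathcal{Y}},$$ where $\tilde{\mathcal{L}}(u)=(l^u(b))_{b\in\mathcal{Y}}$ and $l^u(b)$ is the number of balls of symbol $b$ in bin $u$. Exponential equivalence. Let $d(\mu,\tilde\mu)=\frac12\sum_{(a,l)\in\mathcal{Y}\times\mathbb{N}^{\mathcal{Y}}}|\mu(a,l)-\tilde\mu(a,l)|$ be the total variation metric on $\mathcal{W}(\mathcal{Y}\times\mathbb{N}^{\mathcal{Y}})$. Exponential equivalence means that for each $n$ there is a coupling $\mathbb{P}$ of $M_{\tilde Y}$ (with its law under $\tilde{\mathbb{P}}_{(\nu_n,\pi_n)}$) and $M_Y$ (with its law under $\mathbb{P}_{(\nu_n,\pi_n)}$) such that for every $\varepsilon>0$, $\lim_{n\to\infty}\frac1n\log\mathbb{P}\{d(M_{\tilde Y},M_Y)\ge\varepsilon\}=-\infty$. *)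

(* Defs.v *)
From HB Require Import structures.
From mathcomp Require Import all_boot all_order all_algebra.
From mathcomp Require Import all_classical all_reals all_analysis.

Set Implicit Arguments.
Unset Strict Implicit.
Unset Printing Implicit Defensive.

Import Order.TTheory GRing.Theory Num.Theory.
Import numFieldNormedType.Exports.

Local Open Scope ring_scope.
Local Open Scope classical_set_scope.

Section Models.
Variables (R : realType) (Y : finType).
Implicit Types (nu : Y -> R) (pi : Y -> Y -> R) (n : nat).

(* Measures on a finite or countable set are represented by their point masses. *)

Definition prob_mass nu : Prop :=
  (forall a, 0 <= nu a) /\ \sum_(a : Y) nu a = 1.

Definition sym_mass pi : Prop :=
  (forall a b, 0 <= pi a b) /\ (forall a b, pi a b = pi b a).

Definition prob_mass_n n nu : Prop :=
  prob_mass nu /\ (forall b, n%:R * nu b \is a Num.nat).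

Definition sym_mass_n n pi : Prop :=
  sym_mass pi /\
  (forall a b, n%:R / (1 + (a == b)%:R) * pi b a \is a Num.nat).

(* Under [prob_mass_n] and [sym_mass_n] the truncations below are exact. *)

Definition num_sym n nu (a : Y) : nat := Num.truncn (n%:R * nu a).

Definition num_balls n pi (p : Y * Y) : nat := Num.truncn (n%:R * pi p.1 p.2).

Definition num_edges n pi (b a : Y) : nat :=
  Num.truncn (if a == b then n%:R / 2%:R * pi b a else n%:R * pi b a).

(* Uniform law on [A], as a mass function; it is identically 0 when [A] is
   empty, i.e. when there is nothing to draw from. *)
Definition unif (T : finType) (A : {set T}) (x : T) : R :=
  (x \in A)%:R / #|A|%:R.

(* The possible outcomes of drawing the whole pool of symbols, which contains
   each [a] exactly [num_sym n nu a] times, without replacement; all of them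
   are equally likely. *)
Definition arrangements n nu : {set {ffun 'I_n -> Y}} :=
  [set y : {ffun 'I_n -> Y} |
    [forall a, #|[set v | y v == a]%SET| == num_sym n nu a]]%SET.

Definition symbol_mass n nu : {ffun 'I_n -> Y} -> R := unif (arrangements n nu).

Definition nbh : Type := (Y * {ffun Y -> nat})%type.

Definition empirical n (Z : 'I_n -> nbh) : nbh -> R :=
  fun x => n%:R^-1 * \sum_(u < n) (Z u == x)%:R.

(* An unordered pair {a, b} is represented by whichever of (a, b), (b, a) is
   nondecreasing for the enumeration order of [Y]. *)
Definition upair : finType :=
  {p : Y * Y | (enum_rank p.1 <= enum_rank p.2)%N}.

Definition potential_edges n (y : {ffun 'I_n -> Y}) (a b : Y) :
    {set {set 'I_n}} :=
  [set e : {set 'I_n} | [exists u, exists v,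
    [&& u != v, y u == a, y v == b & e == [set u; v]%SET]]]%SET.

Definition edge_draws n pi (y : {ffun 'I_n -> Y}) (p : upair) :
    {set {set {set 'I_n}}} :=
  [set D : {set {set 'I_n}} |
    (D \subset potential_edges y (val p).1 (val p).2) &&
    (#|D| == num_edges n pi (val p).1 (val p).2)]%SET.

(* Symbols of the vertices, and the edges drawn for each unordered pair. *)
Definition graph_config n : finType :=
  ({ffun 'I_n -> Y} * {ffun upair -> {set {set 'I_n}}})%type.

Definition graph_mass n nu pi (w : graph_config n) : R :=
  symbol_mass nu w.1 * \prod_(p : upair) unif (edge_draws pi w.1 p) (w.2 p).

Definition linked n (w : graph_config n) (u v : 'I_n) : bool :=
  [exists p : upair, [set u; v]%SET \in w.2 p].

Definition graph_empirical n (w : graph_config n) : nbh -> R :=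
  empirical (fun u : 'I_n =>
    (w.1 u, [ffun b => #|[set v | (w.1 v == b) && linked w u v]%SET|])).

(* The ball [Tagged _ i] with tag (b, a) is the i-th ball of symbol b thrown
   into the bins of symbol a. *)
Definition ball n pi : finType := {p : Y * Y & 'I_(num_balls n pi p)}.

(* Symbols of the bins, and the bin receiving each ball. *)
Definition alloc_config n pi : finType :=
  ({ffun 'I_n -> Y} * {ffun ball n pi -> 'I_n})%type.

Definition alloc_mass n nu pi (w : alloc_config n pi) : R :=
  symbol_mass nu w.1 *
  \prod_(k : ball n pi) unif [set v | w.1 v == (tag k).2]%SET (w.2 k).

Definition alloc_empirical n pi (w : alloc_config n pi) : nbh -> R :=
  empirical (fun u : 'I_n =>
    (w.1 u,
     [ffun b => #|[set k : ball n pi | ((tag k).1 == b) && (w.2 k == u)]%SET|])).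

Definition law_of (C : finType) (T : Type) (m : C -> R) (M : C -> T)
    (B : set T) : \bar R :=
  (\sum_(w : C | `[< B (M w) >]) m w)%:E.

Definition graph_law n nu pi : set (nbh -> R) -> \bar R :=
  law_of (@graph_mass n nu pi) (@graph_empirical n).

Definition alloc_law n nu pi : set (nbh -> R) -> \bar R :=
  law_of (@alloc_mass n nu pi) (@alloc_empirical n pi).

Definition dTV (mu mu' : nbh -> R) : \bar R :=
  ((2^-1)%:E * \esum_(x in [set: nbh]) `|mu x - mu' x|%:E)%E.

(* The laws considered are finitely supported, so the space of measures can be
   given the discrete sigma-algebra. *)
Definition is_coupling (dsp : measure_display) (Om : measurableType dsp)
    (P : probability Om R) (T : Type) (X X' : Om -> T)
    (law law' : set T -> \bar R) : Prop :=
  [/\ forall B : set (T * T), measurable [set w | B (X w, X' w)],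
      forall B : set T, P (X @^-1` B) = law B &
      forall B : set T, P (X' @^-1` B) = law' B].

(* For finitely many small [n] a model may be impossible to carry out (no bin
   for some ball, or fewer potential edges than required); its mass function
   is then identically 0.  A coupling is required at each positive [n] for
   which both laws are probability laws, and this must include all large [n]. *)
Definition exponentially_equivalent
    (law law' : nat -> set (nbh -> R) -> \bar R) : Prop :=
  (\forall n \near \oo, law n setT = 1%E /\ law' n setT = 1%E) /\
  exists (dsp : nat -> measure_display)
         (Om : forall n, measurableType (dsp n))
         (P : forall n, probability (Om n) R)
         (X X' : forall n, Om n -> (nbh -> R)),
    (forall n, (0 < n)%N -> law n setT = 1%E -> law' n setT = 1%E ->
       is_coupling (P n) (X n) (X' n) (law n) (law' n)) /\
    (forall eps : R, 0 < eps ->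
       (n%:R^-1%:E * lne (P n [set w | (eps%:E <= dTV (X n w) (X' n w))%E]))%E
         @[n --> \oo] --> -oo%E).

End Models.

(* Main.v *)
Require Import Defs.
From HB Require Import structures.
From mathcomp Require Import all_boot all_order all_algebra perm.
From mathcomp Require Import all_classical all_reals all_analysis.
From mathcomp Require Import ring lra.

(** The two models are realised on one probability space, with the same symbols,
    so that all but superexponentially unlikely outcomes give nearly the same
    empirical measure.

    For two symbols a and b, the balls of symbol a thrown into the bins of
    symbol b and the balls of symbol b thrown into the bins of symbol a are
    equally many, and for a = b the number of balls is even. Hence the balls can
    be paired ([exists_ball_pairing]): each pair, called a slot, draws two bins,
    one in each of the two classes, that is, a uniform pair of vertices. Read as
    edges, the slots give the right number of edges for every unordered pair of
    symbols, but drawn with replacement and possibly with loops. The coupling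
    keeps the set of distinct proper edges and completes it to a set of the
    prescribed size, uniformly among all such completions. When one slot is
    selected for each distinct proper edge, the remaining slots are redundant: they
    give loops or repetitions.

    The completed set is uniform ([sum_mul_unif_completions]) by symmetry: an edge
    given by a slot has the same mass at every potential edge, so that the law of
    the completed set is invariant under all permutations of the potential edges,
    and these act transitively on the sets of given size.

    Outside the end points of the redundant slots and of the edges added by the
    completion, the balls of symbol b in a bin correspond to the neighbours of
    symbol b of the vertex ([card_discrepancy]). There are as many added edges as
    redundant slots, so that the total variation distance is at most 4 / n times
    the number of redundant slots.

    When the slots are examined one after another, each gives a loop or repeats a
    previous edge with conditional probability at most q = O(1/n), because a class
    has about nu(a) n vertices and there are O(n) slots. Hence the
    number of redundant slots has exponential moment at most (1 + z q) ^ O(n)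
    ([redundancy_mgf]), which is bounded in n for each fixed z. Markov's inequality
    gives P(d >= eps) <= const(z) * z ^ (- eps n / 4); since z is arbitrary, the
    exponential rate is infinite. *)

Set Implicit Arguments.
Unset Strict Implicit.
Unset Printing Implicit Defensive.

Import Order.TTheory GRing.Theory Num.Theory.
Import numFieldNormedType.Exports.

Local Open Scope ring_scope.

(** * Bijections with prescribed fibres *)

(** Fibres of equal size are matched one by one. The pairing of the balls, the
    permutations carrying one set of edges to another and the assignments of
    symbols all arise in this way, without an explicit formula. *)
Lemma exists_fibre_bij (A B C : finType) (f : A -> C) (g : B -> C) :
  (forall c, #|[pred x | f x == c]| = #|[pred y | g y == c]|) ->
  exists2 h : A -> B, bijective h & forall x, g (h x) = f x.
Proof.
move=> fg.
pose F c := enum [pred x | f x == c]; pose G c := enum [pred y | g y == c].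
have sFG c : size (F c) = size (G c) by rewrite -!cardE fg.
have inF x : x \in F (f x) by rewrite mem_enum inE.
have ltG x : (index x (F (f x)) < size (G (f x)))%N by rewrite -sFG index_mem.
have y0 (x : A) : B.
  by move: (ltG x); case: (G (f x)) => [|y].
pose h x := nth (y0 x) (G (f x)) (index x (F (f x))).
have gh x : g (h x) = f x.
  have : h x \in G (f x) by rewrite mem_nth.
  by rewrite mem_enum inE => /eqP.
exists h => //; apply: inj_card_bij => [x x' hx|].
  have fx : f x = f x' by rewrite -!gh hx.
  have ltG' : (index x' (F (f x)) < size (G (f x)))%N by rewrite fx ltG.
  move: hx; rewrite /h -fx (set_nth_default (y0 x) (y0 x') ltG') => /eqP.
  rewrite nth_uniq ?enum_uniq// => /eqP; apply: index_inj => //.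
  by rewrite fx.
rewrite -!sum1_card (partition_big g xpredT)// [leqRHS](partition_big f xpredT)//.
by apply: leq_sum => c _; rewrite !sum1_card fg.
Qed.

(** The permutations that fix the complement of E pointwise act transitively on
    the subsets of E of a given size. *)
Lemma exists_perm_on_imset (S : finType) (E D D' : {set S}) :
  D \subset E -> D' \subset E -> #|D| = #|D'| ->
  exists2 s : {perm S}, (s @: D)%SET = D' & perm_on E s.
Proof.
move=> DE D'E DD'.
(* preserving this code means mapping D to D' inside E, and being the identity
   outside E *)
pose code (X : {set S}) x : bool + S :=
  if x \in E then inl (x \in X) else inr x.
have cF (X : {set S}) (c : bool + S) : X \subset E ->
    [pred x | code X x == c] =i
    match c with inl true => X | inl false => (E :\: X)%SET
    | inr z => [set x | (x == z) && (x \notin E)]%SET end.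
  move=> XE; case: c => [[]|z] x; rewrite !inE /code;
    have := fintype.subsetP XE x; case: (x \in E); case: (x \in X) => //= XEx;
    by rewrite ?andbT ?andbF //; have := XEx isT.
have [c|h bh hE] := @exists_fibre_bij S S _ (code D) (code D').
  rewrite !(eq_card (cF _ _ _)) //; case: c => [[]|z] //.
  by rewrite !cardsD (finset.setIidPr DE) (finset.setIidPr D'E) DD'.
have h_inj := bij_inj bh.
have hEE x : (h x \in E) = (x \in E).
  by have := hE x; rewrite /code; case: (h x \in E); case: (x \in E).
have hout x : x \notin E -> h x = x.
  by move=> /[dup] xE; rewrite -hEE => hxE; have := hE x;
     rewrite /code (negbTE xE) (negbTE hxE) => -[].
exists (perm h_inj); last first.
  by apply/fintype.subsetP => x; rewrite inE permE; apply: contraR => /hout ->.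
apply/eqP; rewrite eqEcard card_imset ?DD' ?leqnn ?andbT; last exact: perm_inj.
apply/fintype.subsetP => _ /imsetP[x xD ->]; rewrite permE.
have xE := fintype.subsetP DE _ xD.
by have := hE x; rewrite /code hEE xE xD => -[->].
Qed.

(** Applied to the map from slots to edges, N selects one slot for each edge; the
    slots outside N are the redundant ones. *)
Lemma exists_section (I K : finType) (f : I -> K) (B : {set K}) :
  B \subset (f @: [set: I])%SET ->
  exists N : {set I},
    [/\ #|N| = #|B|, {in N &, injective f} & (f @: N)%SET = B].
Proof.
move=> Bf; pose N := [set i | (f i \in B) && ([pick j | f j == f i] == Some i)]%SET.
have injN : {in N &, injective f}.
  move=> i j; rewrite !inE => /andP[_ /eqP pi] /andP[_ /eqP pj] fij.
  by apply: Some_inj; rewrite -pi -pj fij.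
have imN : (f @: N)%SET = B.
  apply/setP => k; apply/imsetP/idP => [[i + ->]|kB]; first by rewrite inE => /andP[].
  have /imsetP[i0 _ ki0] := fintype.subsetP Bf k kB.
  case Ek : [pick j | f j == k] => [i|]; last first.
    by move: Ek; case: pickP => // /(_ i0); rewrite ki0 eqxx.
  have fi : f i = k by move: Ek; case: pickP => // j /eqP + [<-].
  by exists i; rewrite // inE fi kB Ek eqxx.
by exists N; split => //; rewrite -imN card_in_imset.
Qed.

Lemma card_tag_fibre (P : finType) (N : P -> nat) (q : P) :
  #|[pred k : {p : P & 'I_(N p)} | tag k == q]| = N q.
Proof.
pose F (i : 'I_(N q)) := Tagged (fun p => 'I_(N p)) i.
have F_inj : injective F by move=> i j /eqP; rewrite eq_Tagged => /eqP.
rewrite -[RHS]card_ord -(card_codom F_inj); apply: eq_card => -[p i].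
rewrite !inE /=; apply/eqP/codomP => [pq|[j /(congr1 tag)//]].
by subst p; exists i.
Qed.

Lemma exists_between_card (T : finType) (A E : {set T}) m :
  A \subset E -> (#|A| <= m <= #|E|)%N ->
  exists D : {set T}, [/\ A \subset D, D \subset E & #|D| = m].
Proof.
move=> AE /andP[Am mE].
have : (m - #|A| <= #|E :\: A|)%N by rewrite cardsD (finset.setIidPr AE) leq_sub2r.
move=> /card_geqP[s [us sz sE]].
have sEA x : x \in s -> (x \in E) && (x \notin A).
  by move=> /sE; rewrite inE andbC.
exists (A :|: [set x in s])%SET; rewrite finset.subsetUl; split=> //.
  rewrite finset.subUset AE; apply/fintype.subsetP => x.
  by rewrite inE => /sEA/andP[].
have cs : #|[set x in s]%SET| = size s by rewrite cardsE; exact/card_uniqP.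
rewrite cardsU cs sz (_ : _ :&: _ = finset.set0)%SET ?cards0 ?subn0 ?subnKC//.
apply/eqP/set0Pn => -[x]; rewrite finset.in_setI finset.in_set => /andP[xA /sEA].
by rewrite xA andbF.
Qed.

Lemma card_bigcup_le (I T : finType) (A : {set I}) (F : I -> {set T}) k :
  (forall i, i \in A -> (#|F i| <= k)%N) ->
  (#|\bigcup_(i in A) F i| <= #|A| * k)%N.
Proof.
move=> Fk; rewrite -sum_nat_const.
apply: (big_ind2 (fun (X : {set T}) j => (#|X| <= j)%N)) => //.
  by rewrite cards0.
move=> X1 j1 X2 j2 h1 h2; rewrite (leq_trans (leq_card_setU _ _))//.
exact: leq_add.
Qed.

Lemma set2_inj (T : finType) (u v u' v' : T) : u != v ->
  [set u'; v']%SET = [set u; v]%SET ->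
  (u', v') = (u, v) \/ (u', v') = (v, u).
Proof.
move=> uv /setP eqs; have := eqs u; have := eqs v; have := eqs u'; have := eqs v'.
rewrite !inE !eqxx !orbT /= => /esym/orP[]/eqP -> /esym/orP[]/eqP ->;
  rewrite ?eqxx ?orbb ?(eq_sym v u) ?(negbTE uv) //; by [left|right].
Qed.

(** * Uniform and product masses on finite sets *)

Lemma sum_pair (V : nmodType) (A B : finType) (F : A * B -> V) :
  \sum_x F x = \sum_a \sum_b F (a, b).
Proof.
by rewrite (pair_bigA _ (fun a b => F (a, b))); apply: eq_bigr => -[].
Qed.

Section FiniteMass.
Variable R : realType.

Lemma unif_ge0 (T : finType) (A : {set T}) x : 0 <= unif R A x.
Proof. by rewrite /unif divr_ge0. Qed.

Lemma unif_out (T : finType) (A : {set T}) x : x \notin A -> unif R A x = 0.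
Proof. by rewrite /unif => /negbTE ->; rewrite mul0r. Qed.

Lemma unif_in (T : finType) (A : {set T}) x :
  x \in A -> unif R A x = #|A|%:R^-1.
Proof. by rewrite /unif => ->; rewrite mul1r. Qed.

Lemma sum_unif (T : finType) (A : {set T}) :
  \sum_x unif R A x = (A != finset.set0)%:R.
Proof.
rewrite /unif -mulr_suml -natr_sum -card_gt0.
have -> : (\sum_x (x \in A) = #|A|)%N.
  by rewrite -sum1_card [RHS]big_mkcond; apply: eq_bigr => x _; case: (x \in A).
by case: #|A| => [|k]; rewrite ?mul0r// divff.
Qed.

Lemma sum_unif1 (T : finType) (A : {set T}) x :
  x \in A -> \sum_x unif R A x = 1.
Proof.
by move=> xA; rewrite sum_unif; case: eqP xA => // ->; rewrite finset.in_set0.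
Qed.

Lemma sum_prod_unif (I T : finType) (A : I -> {set T}) :
  \sum_(f : {ffun I -> T}) \prod_i unif R (A i) (f i) =
  [forall i, A i != finset.set0]%:R.
Proof.
rewrite -(bigA_distr_bigA (fun i x => unif R (A i) x)).
under eq_bigr do rewrite sum_unif.
case: forallP => [h|/forallP]; first by rewrite big1// => i _; rewrite h.
by rewrite negb_forall => /existsP[i /negbTE Ai]; rewrite (bigD1 i)//= Ai mul0r.
Qed.

Lemma const_mass_eq (T : finType) (A : {set T}) (f g : T -> R) :
  (forall x, x \notin A -> f x = 0) -> (forall x, x \notin A -> g x = 0) ->
  {in A &, forall x y, f x = f y} -> {in A &, forall x y, g x = g y} ->
  \sum_x f x = \sum_x g x -> f =1 g.
Proof.
move=> f0 g0 fc gc fg x.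
have [xA|xA] := boolP (x \in A); last by rewrite f0 ?g0.
have sumE h : (forall x, x \notin A -> h x = 0) ->
    {in A &, forall x y, h x = h y} -> \sum_x h x = h x *+ #|A| :> R.
  move=> h0 hc; rewrite (bigID (mem A))/= [X in _ + X]big1 ?addr0; last first.
    by move=> y; exact: h0.
  by rewrite -sumr_const; apply: eq_bigr => y yA; exact: hc.
move: fg; rewrite !sumE// => /eqP; rewrite eqrMn2r => /orP[|/eqP//].
by rewrite cards_eq0 => /eqP A0; rewrite A0 finset.in_set0 in xA.
Qed.

Lemma unif_le (T : finType) (A : {set T}) x : unif R A x <= #|A|%:R^-1.
Proof.
by rewrite /unif -[leRHS]mul1r ler_wpM2r ?invr_ge0// lern1 leq_b1.
Qed.

End FiniteMass.

(** Both models draw a uniform arrangement of the symbols and then make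
    independent uniform draws, from sets that depend on the arrangement. The total
    mass is the proportion of arrangements for which no draw is from an empty
    set. *)
Lemma total_mass1P (R : realType) (Q K T : finType) (A : {set Q})
    (B : Q -> K -> {set T}) :
  \sum_(x : Q * {ffun K -> T}) unif R A x.1 * \prod_k unif R (B x.1 k) (x.2 k) = 1
  <-> A != finset.set0 /\ {in A, forall q k, B q k != finset.set0}.
Proof.
rewrite -(pair_bigA _ (fun q (f : {ffun K -> T}) =>
  unif R A q * \prod_k unif R (B q k) (f k)))/=.
under eq_bigr do rewrite -mulr_sumr sum_prod_unif.
split=> [sum1|[A0 B0]]; last first.
  have sA : \sum_q unif R A q = 1 by rewrite sum_unif A0.
  rewrite -[RHS]sA.
  apply: eq_bigr => q _; have [qA|qA] := boolP (q \in A); last first.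
    by rewrite unif_out ?mul0r.
  rewrite (_ : [forall i, _]) ?mulr1//.
  by apply/forallP => k; exact: B0.
have sA1 : \sum_q unif R A q = 1.
  apply/eqP; rewrite eq_le; apply/andP; split.
    by rewrite sum_unif lern1 leq_b1.
  rewrite -[leLHS]sum1; apply: ler_sum => q _.
  by rewrite -[leRHS]mulr1 ler_wpM2l ?unif_ge0// lern1 leq_b1.
have A0 : A != finset.set0.
  by move: sA1; rewrite sum_unif; case: eqP => // _ /eqP; rewrite eq_sym oner_eq0.
split=> // q qA; apply/forallP; apply: contraT => nB.
have : \sum_q unif R A q * (1 - [forall k, B q k != finset.set0]%:R) = 0.
  by under eq_bigr do rewrite mulrBr mulr1; rewrite sumrB sA1 sum1 subrr.
move=> /psumr_eq0P-/(_ _ q isT); rewrite (negbTE nB) subr0 mulr1 unif_in//.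
move=> /(_ _)/eqP; rewrite invr_eq0 pnatr_eq0 cards_eq0 (negbTE A0).
by apply=> x _; rewrite mulr_ge0 ?unif_ge0// subr_ge0 lern1 leq_b1.
Qed.

(** * Completing a partial draw to a uniform draw *)

Section Completion.
(** The indices in I are split into types by tau. Each index of type p draws one
    point of S, and a set of m p points of E p is wanted for each type p. *)
Variables (R : realType) (I P S : finType) (tau : I -> P).
Variables (E : P -> {set S}) (m : P -> nat).

Definition hits (g : {ffun I -> S}) (p : P) : {set S} :=
  E p :&: (g @: [set i | tau i == p])%SET.

Definition draws (p : P) : {set {set S}} :=
  [set D : {set S} | (D \subset E p) && (#|D| == m p)]%SET.

Definition completions (g : {ffun I -> S}) (p : P) : {set {set S}} :=
  [set D in draws p | hits g p \subset D]%SET.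

Lemma completions_neq0 g p : (#|[set i | tau i == p]%SET| <= m p)%N ->
  draws p != finset.set0 -> completions g p != finset.set0.
Proof.
move=> mp /set0Pn[D0]; rewrite inE => /andP[D0E /eqP D0m].
have hE : hits g p \subset E p by exact: finset.subsetIl.
have hm : (#|hits g p| <= m p)%N.
  rewrite (leq_trans (subset_leq_card (finset.subsetIr _ _)))//.
  by rewrite (leq_trans (leq_imset_card _ _)).
have [|D [hD DE Dm]] := exists_between_card hE (m := m p).
  by rewrite hm -D0m subset_leq_card.
by apply/set0Pn; exists D; rewrite !inE DE Dm eqxx.
Qed.

Variable rho : P -> S -> R.
Variable r : P -> R.
Hypothesis rho1 : forall i, \sum_s rho (tau i) s = 1.
Hypothesis rhoE : forall p s, s \in E p -> rho p s = r p.

Let law (D : {ffun P -> {set S}}) : R :=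
  \sum_(g : {ffun I -> S})
    (\prod_i rho (tau i) (g i)) * \prod_p unif R (completions g p) (D p).

(** Permuting the drawn points together with the completed sets preserves the mass,
    because rho is constant on E p and the permutations fix all points outside
    E p. *)
Lemma law_perm (s : P -> {perm S}) (D : {ffun P -> {set S}}) :
  (forall p, perm_on (E p) (s p)) ->
  law [ffun p => s p @: D p]%SET = law D.
Proof.
move=> sE; rewrite /law.
pose G (t : P -> {perm S}) (g : {ffun I -> S}) := [ffun i => t (tau i) (g i)].
have GK : cancel (G s) (G (fun p => (s p)^-1)%g).
  by move=> g; apply/ffunP => i; rewrite !ffunE permK.
have GK' : cancel (G (fun p => (s p)^-1)%g) (G s).
  by move=> g; apply/ffunP => i; rewrite !ffunE permKV.
have sEE p x : (s p x \in E p) = (x \in E p) by rewrite perm_closed.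
have sEs p : (s p @: E p)%SET = E p.
  apply/eqP; rewrite eqEcard card_imset ?leqnn ?andbT; last exact: perm_inj.
  by apply/fintype.subsetP => _ /imsetP[x xE ->]; rewrite sEE.
rewrite (reindex (G s)); last by exists (G (fun p => (s p)^-1)%g) => g _.
apply: eq_bigr => g _; congr (_ * _).
  apply: eq_bigr => i _; rewrite ffunE.
  have [iE|iE] := boolP (g i \in E (tau i)); last by rewrite (out_perm (sE _)).
  by rewrite !rhoE ?sEE.
apply: eq_bigr => p _; rewrite ffunE.
have hG : hits (G s g) p = (s p @: hits g p)%SET.
  rewrite /hits imsetI; last by move=> x y _ _; exact: perm_inj.
  rewrite sEs; congr (_ :&: _)%SET; rewrite -imset_comp.
  by apply: eq_in_imset => i; rewrite inE ffunE => /eqP ->.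
have sS (X Y : {set S}) :
    (s p @: X \subset s p @: Y)%SET = (X \subset Y).
  apply/idP/idP => [|/imsetS//].
  move=> /fintype.subsetP XY; apply/fintype.subsetP => x xX.
  by have /XY/imsetP[y yY /perm_inj ->] := imset_f (s p) xX.
have cG (D' : {set S}) :
    ((s p @: D')%SET \in completions (G s g) p) = (D' \in completions g p).
  rewrite !inE hG card_imset; last exact: perm_inj.
  by rewrite -{1}sEs !sS.
rewrite /unif cG; congr (_ / _%:R).
rewrite -(card_imset (completions g p) (imset_inj (@perm_inj _ (s p)))).
apply: eq_card => D'.
have -> : D' = (s p @: ((s p)^-1%g @: D'))%SET.
  by rewrite -imset_comp -[LHS]imset_id; apply: eq_imset => x /=; rewrite permKV.
by rewrite cG mem_imset//; exact: (imset_inj (@perm_inj _ (s p))).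
Qed.

(** By [law_perm] the law of the completed sets is constant on the families of
    sets of the right sizes, and it vanishes elsewhere. So does the product of
    the uniform laws, and both have total mass 1. *)
Lemma sum_mul_unif_completions :
  (forall p, #|[set i | tau i == p]%SET| <= m p)%N ->
  (forall p, draws p != finset.set0) ->
  forall D : {ffun P -> {set S}},
  \sum_(g : {ffun I -> S})
    (\prod_i rho (tau i) (g i)) * \prod_p unif R (completions g p) (D p) =
  \prod_p unif R (draws p) (D p).
Proof.
move=> mP d0 D; rewrite -/(law D).
pose A := [set D : {ffun P -> {set S}} | [forall p, D p \in draws p]]%SET.
pose f (D : {ffun P -> {set S}}) := \prod_p unif R (draws p) (D p).
rewrite -/(f D); apply: (@const_mass_eq _ _ A) => {D}.
- move=> D; rewrite inE negb_forall => /existsP[p pD].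
  rewrite /law big1// => g _; rewrite (bigD1 p)//= unif_out ?mul0r ?mulr0//.
  by rewrite inE negb_and pD.
- move=> D; rewrite inE negb_forall => /existsP[p pD].
  by rewrite /f (bigD1 p)//= unif_out ?mul0r.
- move=> D D'; rewrite !inE => /forallP AD /forallP AD'.
  have sP p : exists s : {perm S}, ((s @: D p)%SET == D' p) && perm_on (E p) s.
    have := AD p; have := AD' p.
    rewrite !inE => /andP[D'E /eqP D'm] /andP[DE /eqP Dm].
    have [s sD sE] := exists_perm_on_imset DE D'E (etrans Dm (esym D'm)).
    by exists s; rewrite sD eqxx.
  rewrite -(@law_perm (fun p => xchoose (sP p))); last first.
    by move=> p; have /andP[] := xchooseP (sP p).
  congr law; apply/ffunP => p; rewrite ffunE.
  by have /andP[/eqP] := xchooseP (sP p).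
- move=> D D'; rewrite !inE => /forallP AD /forallP AD'.
  by apply: eq_bigr => p _; rewrite !unif_in.
rewrite /law exchange_big/= /f sum_prod_unif.
under eq_bigr => g _.
  rewrite -mulr_sumr sum_prod_unif.
  have -> : [forall p, completions g p != finset.set0].
    by apply/forallP => p; exact: completions_neq0.
  rewrite mulr1; over.
rewrite -(bigA_distr_bigA (fun i x => rho (tau i) x)) big1//.
by case: forallP.
Qed.

End Completion.

(** * Exponential moment of the number of redundant draws *)

Section Redundancy.
Variables (R : realType) (I S K : finType) (rho : I -> S -> R).
Hypothesis rho_ge0 : forall i s, 0 <= rho i s.
Hypothesis rho1 : forall i, \sum_s rho i s = 1.

Let w (g : {ffun I -> S}) := \prod_i rho i (g i).

(** Redrawing one coordinate does not change the law of g: the involution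
    (g, s) |-> (g with s at i, g i) preserves the product mass. *)
Lemma sum_resample (i : I) (H : {ffun I -> S} -> R) :
  \sum_g w g * H g =
  \sum_g w g * \sum_s rho i s * H [ffun j => if j == i then s else g j].
Proof.
pose upd (g : {ffun I -> S}) s := [ffun j => if j == i then s else g j].
have updK g s t : upd (upd g s) t = upd g t.
  by apply/ffunP => j; rewrite !ffunE; case: eqP.
have upd_id g : upd g (g i) = g.
  by apply/ffunP => j; rewrite !ffunE; case: eqP => [->|].
have updi g s : upd g s i = s by rewrite ffunE eqxx.
under [RHS]eq_bigr do rewrite mulr_sumr.
rewrite pair_big/= (reindex (fun x => (upd x.1 x.2, x.1 i)))/=; last first.
  by exists (fun x => (upd x.1 x.2, x.1 i)) => -[g s] _ /=;
    rewrite updK upd_id updi.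
under [RHS]eq_bigr => x _.
  rewrite -/(upd _ _) updK upd_id mulrA.
  have -> : w (upd x.1 x.2) * rho i (x.1 i) = w x.1 * rho i x.2.
    rewrite /w (bigD1 i)//= updi [in RHS](bigD1 i)//= mulrC mulrA.
    rewrite [RHS]mulrAC; congr (_ * _ * _); apply: eq_bigr => j /negbTE ji.
    by rewrite ffunE ji.
  over.
rewrite -(pair_bigA _ (fun g s => w g * rho i s * H g))/=; apply: eq_bigr => g _.
by rewrite -mulr_suml -mulr_sumr rho1 mulr1.
Qed.

(** The draw s at index i counts as the point psi i s of K; it is of use if this
    point lies in E and has not been found before. By [q_bound] it is of no use
    with probability at most q, whatever set A has been found before. *)
Variables (psi : I -> S -> K) (E : {set K}) (z q : R).
Hypothesis z1 : 1 <= z.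
Hypothesis q_bound : forall i (A : {set K}), A \subset E -> (#|A| <= #|I|)%N ->
  \sum_(s | psi i s \notin E :\: A) rho i s <= q.

Let found (r : seq I) (g : {ffun I -> S}) : {set K} :=
  (E :&: [set k in [seq psi i (g i) | i <- r]])%SET.

(** Induction on the list of indices: redrawing the first coordinate, given the
    points found by the others, multiplies the moment by at most
    1 + z * (probability that the draw is of no use). *)
Let mgf_seq (r : seq I) : uniq r ->
  \sum_g w g * z ^+ (size r - #|found r g|) <= (1 + z * q) ^+ size r.
Proof.
have z0 : 0 <= z by rewrite (le_trans ler01).
have w0 g : 0 <= w g by apply: prodr_ge0.
elim: r => [_|i r IH /= /andP[ir ur]].
  under eq_bigr do rewrite /= sub0n expr0 mulr1.
  rewrite /= expr0 -(bigA_distr_bigA rho) big1//.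
rewrite (sum_resample i) exprS.
have foundr g : (#|found r g| <= size r)%N.
  rewrite (leq_trans (subset_leq_card (finset.subsetIr _ _)))// cardsE.
  by rewrite (leq_trans (card_size _))// size_map.
have sr : (size r <= #|I|)%N by rewrite -(card_uniqP ur) max_card.
have q0 : 0 <= 1 + z * q.
  rewrite addr_ge0// mulr_ge0//.
  have := q_bound i (finset.sub0set E); rewrite cards0 => /(_ isT).
  by apply: le_trans; apply: sumr_ge0.
apply: le_trans (ler_wpM2l q0 (IH ur)).
rewrite mulr_sumr; apply: ler_sum => g _.
rewrite mulrCA ler_wpM2l//.
set A := found r g.
have step s : z ^+ ((size r).+1 -
      #|found (i :: r) [ffun j => if j == i then s else g j]|) <=
    z ^+ (size r - #|A|) * (1 + (psi i s \notin E :\: A)%:R * z).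
  have -> : found (i :: r) [ffun j => if j == i then s else g j] =
      (A :|: (E :&: [set psi i s]))%SET.
    have same : [seq psi j ([ffun j => if j == i then s else g j] j) | j <- r] =
        [seq psi j (g j) | j <- r].
      by apply/eq_in_map => j jr; rewrite ffunE; case: eqP jr ir => // -> ->.
    apply/setP => k; rewrite /found map_cons same ffunE eqxx !inE.
    by rewrite -andb_orr orbC.
  have [new|old] := boolP (psi i s \in (E :\: A)%SET).
    rewrite mul0r addr0 mulr1.
    move: new; rewrite inE => /andP[nA nE].
    have -> : (E :&: [set psi i s])%SET = [set psi i s]%SET.
      by apply/finset.setIidPr; rewrite finset.sub1set.
    rewrite finset.setUC cardsU1 nA.
    by rewrite add1n subSS.
  rewrite (_ : _ :|: _ = A)%SET.
    rewrite subSn ?foundr// exprS mulrC mul1r ler_wpM2l ?exprn_ge0//.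
    by rewrite lerDr.
  apply/finset.setUidPl/fintype.subsetP => k; rewrite !inE => /andP[kE /eqP kpsi].
  by move: old; rewrite -kpsi finset.in_setD kE andbT negbK finset.in_setI kE inE.
apply: (@le_trans _ _ (\sum_s rho i s *
    (z ^+ (size r - #|A|) * (1 + (psi i s \notin E :\: A)%:R * z)))).
  by apply: ler_sum => s _; rewrite ler_wpM2l.
under eq_bigr do rewrite mulrCA.
rewrite -mulr_sumr mulrC ler_wpM2r ?exprn_ge0//.
under eq_bigr do rewrite mulrDr mulr1.
rewrite big_split/= rho1 lerD2l.
under eq_bigr do rewrite mulrA.
rewrite -mulr_suml mulrC ler_wpM2l//.
have := q_bound i (finset.subsetIl E [set k in [seq psi i (g i) | i <- r]]%SET).
rewrite -/(found r g) => /(_ (leq_trans (foundr g) sr)).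
rewrite big_mkcond/=; apply: le_trans; apply: ler_sum => s _.
by rewrite -/A; case: (_ \notin _); rewrite ?mulr1 ?mulr0.
Qed.

(** Here #|I| minus the number of points found is the number of draws that are of
    no use. *)
Lemma redundancy_mgf :
  \sum_(g : {ffun I -> S}) (\prod_i rho i (g i)) *
    z ^+ (#|I| - #|E :&: [set psi i (g i) | i in I]|%SET) <= (1 + z * q) ^+ #|I|.
Proof.
have := mgf_seq (enum_uniq I); rewrite -cardT; apply: le_trans.
rewrite le_eqVlt; apply/orP; left; apply/eqP; apply: eq_bigr => g _.
congr (_ * _ ^+ (_ - _)); apply: eq_card => k; rewrite !inE; congr (_ && _).
apply/imsetP/mapP => [[i _ ->]|[i _ ->]]; first by exists i; rewrite ?mem_enum.
by exists i.
Qed.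

End Redundancy.

(** * Pairing the balls into edges *)

Section Pairing.
Variables (R : realType) (Y : finType) (n : nat) (pi : Y -> Y -> R).

(** The i-th edge to be drawn for the unordered pair p. *)
Definition slot : finType :=
  {p : upair Y & 'I_(num_edges n pi (val p).1 (val p).2)}.

(** The symbols of the ball at the end x of a slot of type p and of the bins that
    it is thrown into: the end false falls into the class of (val p).1, the end
    true into the class of (val p).2, and each end carries the symbol of the
    other class. *)
Definition slot_dir (p : upair Y) (x : bool) : Y * Y :=
  if x then val p else ((val p).2, (val p).1).

Lemma slot_dirN p x : slot_dir p (~~ x) = ((slot_dir p x).2, (slot_dir p x).1).
Proof. by case: x => //=; case: (val p). Qed.

Lemma slot_dir_inj p p' x x' : slot_dir p x = slot_dir p' x' -> p = p'.
Proof.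
move=> pp'; apply: val_inj; move: pp'; rewrite /slot_dir.
case: p => -[a b] /= ab; case: p' => -[a' b'] /= ab'.
(* an ordered and a reversed pair agree only on the diagonal *)
have bal c d : (enum_rank c <= enum_rank d)%N -> (enum_rank d <= enum_rank c)%N ->
    c = d :> Y.
  by move=> cd dc; apply/enum_rank_inj/val_inj/anti_leq; rewrite cd dc.
case: x x' => -[] // -[]; move=> *; subst => //.
- by rewrite (bal _ _ ab ab').
- by rewrite (bal _ _ ab ab').
Qed.

Hypotheses (pi_sym : sym_mass_n n pi).

Lemma num_edges_sym a b : num_edges n pi a b = num_edges n pi b a.
Proof. by case: pi_sym => -[_ sym] _; rewrite /num_edges eq_sym sym. Qed.

Lemma num_balls_neq a b : a != b -> num_balls n pi (b, a) = num_edges n pi b a.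
Proof. by move=> /negbTE ab; rewrite /num_balls /num_edges/= ab. Qed.

Lemma num_balls_eq a : num_balls n pi (a, a) = (num_edges n pi a a).*2.
Proof.
rewrite /num_balls /num_edges/= eqxx.
case: pi_sym => _ /(_ a a); rewrite eqxx/= => /natrP[k kE].
have -> : n%:R * pi a a = (k.*2)%:R.
  by rewrite -muln2 natrM -kE; field.
have kE' : n%:R / 2%:R * pi a a = k%:R by rewrite -kE.
by rewrite kE' !natrK.
Qed.

(** The unordered pair {c.1, c.2} is represented by c in one order only, hence the
    case distinction. *)
Lemma card_slot_fibre (c : Y * Y) :
  #|[pred s : slot | val (tag s) == c]| =
  if (enum_rank c.1 <= enum_rank c.2)%N then num_edges n pi c.1 c.2 else 0%N.
Proof.
case: ifP => [cle|/negbT cgt]; last first.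
  apply: eq_card0 => -[p i]; rewrite inE /=; apply: contraNF cgt => /eqP <-.
  exact: (valP p).
pose p0 : upair Y := Sub c cle.
rewrite -(card_tag_fibre (fun p : upair Y => num_edges n pi (val p).1 (val p).2) p0).
by apply: eq_card => s; rewrite !inE.
Qed.

(** Balls with tag (b, a) and ends of slots with direction (b, a) are equally many.
    For a <> b only one of the two ends of the slots of type {a, b} has this
    direction; for a = b both ends have it, and there are twice as many balls as
    edges. *)
Lemma exists_ball_pairing : exists2 h : slot * bool -> Defs.ball n pi,
  bijective h & forall s x, tag (h (s, x)) = slot_dir (tag s) x.
Proof.
have [[b a]|h bh hE] := @exists_fibre_bij (slot * bool)%type (Defs.ball n pi) _
    (fun sx => slot_dir (tag sx.1) sx.2) (fun k => tag k); last first.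
  by exists h => // s x; rewrite hE.
rewrite (card_tag_fibre (num_balls n pi)).
have -> : #|[pred sx : slot * bool | slot_dir (tag sx.1) sx.2 == (b, a)]| =
    (#|[pred s : slot | val (tag s) == (b, a)]| +
     #|[pred s : slot | val (tag s) == (a, b)]|)%N.
  rewrite -[LHS]sum1_card -[X in (X + _)%N]sum1_card -[X in (_ + X)%N]sum1_card.
  rewrite big_mkcond -(pair_bigA _ (fun s x =>
    if slot_dir (tag s) x == (b, a) then 1 else 0)%N)/= exchange_big/= big_bool/=.
  rewrite -!big_mkcond/=; congr (_ + _)%N; apply: eq_bigl => s.
  by rewrite inE; case: (val (tag s)) => c d; rewrite !xpair_eqE andbC.
rewrite !card_slot_fibre/=.
case: (ltngtP (enum_rank b) (enum_rank a)) => ab.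
- by rewrite addn0 num_balls_neq//; apply: contraTneq ab => ->; rewrite ltnn.
- rewrite add0n num_edges_sym num_balls_neq//.
  by apply: contraTneq ab => ->; rewrite ltnn.
- have -> : b = a by apply/enum_rank_inj/val_inj.
  by rewrite num_balls_eq addnn.
Qed.

End Pairing.

(** * Redundant draws bound the number of differing neighbourhoods *)

Section Discrepancy.
Variables (R : realType) (Y : finType) (n : nat) (pi : Y -> Y -> R).
Variable h : slot n pi * bool -> Defs.ball n pi.

(** A singleton when both balls of the slot fall into the same bin. *)
Definition slot_edge (w : {ffun Defs.ball n pi -> 'I_n}) :
    {ffun slot n pi -> {set 'I_n}} :=
  [ffun s => [set w (h (s, false)); w (h (s, true))]%SET].

Definition class_edges (y : {ffun 'I_n -> Y}) (p : upair Y) : {set {set 'I_n}} :=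
  potential_edges y (val p).1 (val p).2.

Definition class_size (p : upair Y) : nat :=
  num_edges n pi (val p).1 (val p).2.

Definition all_edges (y : {ffun 'I_n -> Y}) : {set upair Y * {set 'I_n}} :=
  [set x : upair Y * {set 'I_n} | x.2 \in class_edges y x.1]%SET.

(** The distinct proper edges given by the slots, for all types at once; the type is
    kept with the edge. *)
Definition all_hits (y : {ffun 'I_n -> Y}) (g : {ffun slot n pi -> {set 'I_n}}) :
    {set upair Y * {set 'I_n}} :=
  (all_edges y :&: [set (tag s, g s) | s in slot n pi])%SET.

Lemma class_edgesP (y : {ffun 'I_n -> Y}) p e :
  reflect (exists u v, [/\ u != v, y u = (val p).1, y v = (val p).2 &
                           e = [set u; v]%SET])
    (e \in class_edges y p).
Proof.
rewrite inE; apply: (iffP existsP).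
  move=> [u /existsP[v /and4P[uv /eqP yu /eqP yv /eqP ->]]].
  by exists u, v.
move=> [u [v [uv yu yv ->]]].
by exists u; apply/existsP; exists v; rewrite uv yu yv !eqxx.
Qed.

Lemma card_class_edge (y : {ffun 'I_n -> Y}) p e : e \in class_edges y p -> #|e| = 2%N.
Proof. by move=> /class_edgesP[u [v [uv _ _ ->]]]; rewrite cards2 uv. Qed.

Lemma mem_all_hits y g p e :
  ((p, e) \in all_hits y g) = (e \in hits (fun s => tag s) (class_edges y) g p).
Proof.
rewrite [RHS]finset.in_setI [LHS]finset.in_setI inE; congr (_ && _).
apply/imsetP/imsetP => [[s _ [-> ->]]|[s + ->]]; first by exists s; rewrite ?inE.
by rewrite inE => /eqP <-; exists s.
Qed.

Lemma card_slot : #|slot n pi| = (\sum_p class_size p)%N.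
Proof.
rewrite card_tagged sumnE big_map big_enum/=.
by apply: eq_bigr => p _; rewrite card_ord.
Qed.

Hypotheses (hbij : bijective h)
  (hE : forall s x, tag (h (s, x)) = slot_dir (tag s) x).

Variables (y : {ffun 'I_n -> Y}) (w : {ffun Defs.ball n pi -> 'I_n}).
Variable D : {ffun upair Y -> {set {set 'I_n}}}.
Hypothesis yw : forall k, y (w k) = (tag k).2.
Hypothesis compD : forall p, D p \in
  completions (fun s : slot n pi => tag s) (class_edges y) class_size (slot_edge w) p.

Let occupancy u : {ffun Y -> nat} :=
  [ffun b => #|[set k : Defs.ball n pi | ((tag k).1 == b) && (w k == u)]%SET|].
Let degree u : {ffun Y -> nat} :=
  [ffun b => #|[set v | (y v == b) && linked (y, D) u v]%SET|].

Let g := slot_edge w.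
Let H := all_hits y g.

Let DE p : D p \subset class_edges y p.
Proof. by have := compD p; rewrite !inE => /andP[/andP[]]. Qed.

Let Dm p : #|D p| = class_size p.
Proof. by have := compD p; rewrite !inE => /andP[/andP[_ /eqP]]. Qed.

Let HD p e : (p, e) \in H -> e \in D p.
Proof.
rewrite mem_all_hits; have := compD p; rewrite inE => /andP[_].
by move=> /fintype.subsetP; apply.
Qed.

Let gE s x : g s = [set w (h (s, x)); w (h (s, ~~ x))]%SET.
Proof. by rewrite ffunE; case: x; rewrite //= finset.setUC. Qed.

Let allD := [set x : upair Y * {set 'I_n} | x.2 \in D x.1]%SET.

Let card_allD : #|allD| = #|slot n pi|.
Proof.
rewrite card_slot -sum1_card.
under [RHS]eq_bigr do rewrite -Dm -sum1_card.
rewrite pair_big_dep/=; apply: eq_bigl => -[p e].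
by rewrite inE.
Qed.

(** With N one slot for each edge found, every redundant slot and every added edge
    spoils at most two vertices, and both kinds are #|slot n pi| - #|H| in number.
    In any other bin u, sending a ball to the bin of the other ball of its slot
    is a bijection from the balls of symbol b in u to the neighbours of symbol b
    of u. *)
Lemma card_discrepancy :
  (#|[set u | occupancy u != degree u]%SET| <= 4 * (#|slot n pi| - #|H|))%N.
Proof.
have [|N [NH N_inj NE]] := @exists_section (slot n pi) _ (fun s => (tag s, g s)) H.
  by apply/fintype.subsetP => x /setIP[_ /imsetP[s _ ->]]; apply/imsetP; exists s.
have HallD : H \subset allD.
  by apply/fintype.subsetP => -[p e] /HD; rewrite inE.
have cardN : #|(~: N)%SET| = (#|slot n pi| - #|H|)%N.
  by rewrite cardsCs finset.setCK NH.
have cardX : #|(allD :\: H)%SET| = (#|slot n pi| - #|H|)%N.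
  by rewrite cardsD (finset.setIidPr HallD) card_allD.
pose Bad := ((\bigcup_(s in ~: N) g s) :|: (\bigcup_(x in allD :\: H) x.2))%SET.
apply: (@leq_trans #|Bad|); last first.
  rewrite (leq_trans (leq_card_setU _ _))//.
  have -> : (4 * (#|slot n pi| - #|H|) =
      (#|slot n pi| - #|H|) * 2 + (#|slot n pi| - #|H|) * 2)%N.
    by rewrite -mulnDr mulnC.
  apply: leq_add; [rewrite -cardN|rewrite -cardX]; apply: card_bigcup_le => x.
    by move=> _; rewrite ffunE cards2 -addn1 addnC leq_add2l leq_b1.
  rewrite finset.in_setD => /andP[_]; rewrite inE => xD.
  by rewrite (card_class_edge (fintype.subsetP (DE _) _ xD)).
apply: subset_leq_card; apply/fintype.subsetP => u; rewrite inE.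
apply: contraR => uBad; apply/eqP/ffunP => b; rewrite !ffunE.
have uN s : u \in g s -> s \in N.
  move=> us; apply: contraR uBad => sN; rewrite inE; apply/orP; left.
  by apply/bigcupP; exists s; rewrite ?inE.
have uH p e : e \in D p -> u \in e -> (p, e) \in H.
  move=> eD ue; apply: contraR uBad => eH; rewrite inE; apply/orP; right.
  by apply/bigcupP; exists (p, e); rewrite // finset.in_setD eH inE.
have [hi hK Kh] := hbij.
pose other k := let sx := hi k in w (h (sx.1, ~~ sx.2)).
have otherE s x : other (h (s, x)) = w (h (s, ~~ x)) by rewrite /other hK.
have ballu s x : w (h (s, x)) = u ->
   [/\ s \in N, (tag s, g s) \in H, g s = [set u; other (h (s, x))]%SET &
     u != other (h (s, x))].
  move=> wu; have gsE := gE s x; rewrite wu -otherE in gsE.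
  have sN : s \in N by apply: uN; rewrite gsE !inE eqxx.
  have sH : (tag s, g s) \in H by rewrite -NE; apply/imsetP; exists s.
  split=> //; have := card_class_edge (fintype.subsetP (DE _) _ (HD sH)).
  by rewrite gsE cards2; case: (_ != _).
rewrite -(card_in_imset (f := other)).
  apply: eq_card => v; rewrite [RHS]inE; apply/imsetP/andP.
    move=> [k]; rewrite -(Kh k); case: (hi k) => s x.
    rewrite !inE hE => /andP[/eqP bE /eqP wu] vE.
    have [sN sH gs uo] := ballu _ _ wu.
    rewrite -vE in gs uo; split.
      by rewrite vE otherE yw hE slot_dirN /= bE.
    by apply/existsP; exists (tag s); rewrite /= -gs; exact: HD sH.
  move=> [/eqP yv /existsP[p /= uvD]].
  have uvH : (p, [set u; v]%SET) \in H by apply: uH; rewrite // !inE eqxx.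
  have uv : u != v.
    have := card_class_edge (fintype.subsetP (DE _) _ uvD).
    by rewrite cards2; case: (_ != _).
  move: (uvH); rewrite -NE => /imsetP[s sN [ps gs]].
  have [x wu] : exists x, w (h (s, x)) = u.
    have : u \in g s by rewrite -gs !inE eqxx.
    by rewrite ffunE !inE => /orP[/eqP ->|/eqP ->]; [exists false|exists true].
  have [_ _ gs' uo] := ballu _ _ wu.
  have vo : v = other (h (s, x)).
    have : v \in g s by rewrite -gs !inE eqxx orbT.
    by rewrite gs' !inE eq_sym (negbTE uv) /= => /eqP.
  exists (h (s, x)) => //; rewrite !inE wu eqxx andbT hE.
  by rewrite -yv vo otherE yw hE slot_dirN.
move=> k k'; rewrite -(Kh k) -(Kh k'); case: (hi k) => s x; case: (hi k') => s' x'.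
rewrite !inE !hE => /andP[/eqP bE /eqP wu] /andP[/eqP bE' /eqP wu'] oo.
have [sN _ gs uo] := ballu _ _ wu.
have [sN' _ gs' _] := ballu _ _ wu'.
have dirE : slot_dir (tag s) x = slot_dir (tag s') x'.
  rewrite [LHS]surjective_pairing [RHS]surjective_pairing bE bE' -!hE -!yw.
  by rewrite wu wu'.
have ss' : s = s'.
  by apply: N_inj => //; rewrite (slot_dir_inj dirE) gs gs' oo.
subst s'; congr (h (s, _)).
apply/eqP; apply: contraT => xx'.
have x'E : x' = ~~ x by case: x x' xx' {wu wu' bE bE' oo uo gs gs' dirE} => -[].
by move: uo; rewrite otherE -x'E wu' eqxx.
Qed.

End Discrepancy.

(** * Law of the edge joined by a pair of balls *)

Section EdgeMass.
Variables (R : realType) (Y : finType) (n : nat).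

Definition sym_class (y : {ffun 'I_n -> Y}) (a : Y) : {set 'I_n} :=
  [set v | y v == a]%SET.

(** The law of the unordered pair of bins hit by the two balls of a slot of type
    p. *)
Definition edge_mass (y : {ffun 'I_n -> Y}) (p : upair Y) (e : {set 'I_n}) : R :=
  \sum_(t : 'I_n * 'I_n | [set t.1; t.2]%SET == e)
    unif R (sym_class y (val p).1) t.1 * unif R (sym_class y (val p).2) t.2.

Lemma edge_mass_ge0 y p e : 0 <= edge_mass y p e.
Proof. by apply: sumr_ge0 => t _; rewrite mulr_ge0 ?unif_ge0. Qed.

Lemma sum_edge_mass y p :
  \sum_e edge_mass y p e = (\sum_u unif R (sym_class y (val p).1) u) *
                           (\sum_v unif R (sym_class y (val p).2) v).
Proof.
transitivity (\sum_(t : 'I_n * 'I_n)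
    unif R (sym_class y (val p).1) t.1 * unif R (sym_class y (val p).2) t.2).
  by rewrite [RHS](partition_big (fun t => [set t.1; t.2]%SET) xpredT).
rewrite mulr_suml -(pair_bigA _ (fun u v =>
  unif R (sym_class y (val p).1) u * unif R (sym_class y (val p).2) v))/=.
by apply: eq_bigr => u _; rewrite mulr_sumr.
Qed.

(** A potential edge arises from two ordered pairs of bins if both ends are in the
    same class, and from one otherwise. What matters is that the value does not
    depend on e. *)
Lemma edge_massE y p e : e \in class_edges y p ->
  edge_mass y p e = (1 + ((val p).1 == (val p).2)%:R) *
    (#|sym_class y (val p).1|%:R^-1 * #|sym_class y (val p).2|%:R^-1).
Proof.
move=> /class_edgesP[u [v [uv yu yv ->]]].
rewrite /edge_mass (bigD1 (u, v))//= (bigD1 (v, u))/=; last first.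
  by rewrite finset.setUC eqxx/= xpair_eqE negb_and (eq_sym v) uv.
rewrite big1 ?addr0; last first.
  by move=> [u' v'] /= /andP[/andP[/eqP /(set2_inj uv)[] ->]]; rewrite eqxx.
rewrite mulrDl mul1r; congr (_ + _).
  by rewrite !unif_in// inE ?yu ?yv.
by rewrite /unif !inE yu yv eq_sym; case: eqP => [->|]; rewrite ?mul0r ?mul1r.
Qed.

(** A loop has probability at most kappa, and an edge found before has mass at most
    2 kappa ^ 2. *)
Lemma edge_mass_bound (y : {ffun 'I_n -> Y}) (kappa : R) (p : upair Y) N
    (A : {set upair Y * {set 'I_n}}) :
  (forall a, #|sym_class y a|%:R^-1 <= kappa) ->
  A \subset all_edges y -> (#|A| <= N)%N ->
  \sum_(e | (p, e) \notin all_edges y :\: A) edge_mass y p e <=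
    kappa + 2 * N%:R * kappa ^+ 2.
Proof.
move=> yk AE AN.
have k0 : 0 <= kappa by apply: le_trans (yk (val p).1); rewrite invr_ge0.
apply: (@le_trans _ _ (\sum_(e | e \notin class_edges y p) edge_mass y p e +
    \sum_(e | (p, e) \in A) edge_mass y p e)).
  rewrite [leLHS]big_mkcond [X in _ <= X + _]big_mkcond [X in _ <= _ + X]big_mkcond.
  rewrite -big_split/=; apply: ler_sum => e _.
  have m0 := edge_mass_ge0 y p e.
  rewrite finset.in_setD [X in _ && X]inE /= negb_and negbK.
  by do 2 case: (_ \in _) => /=; rewrite ?addr0 ?add0r ?lerDl.
apply: lerD.
  (* off the potential edges only the diagonal carries mass *)
  pose F (t : 'I_n * 'I_n) :=
    unif R (sym_class y (val p).1) t.1 * unif R (sym_class y (val p).2) t.2.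
  have -> : \sum_(e | e \notin class_edges y p) edge_mass y p e =
      \sum_(t | [set t.1; t.2]%SET \notin class_edges y p) F t.
    rewrite (partition_big (fun t => [set t.1; t.2]%SET)
      (fun e => e \notin class_edges y p))//=.
    apply: eq_bigr => e eE; apply: eq_bigl => t.
    by case: eqP => [->|_]; rewrite ?eE ?andbF.
  apply: (@le_trans _ _ (\sum_(t : 'I_n * 'I_n)
      (t.1 == t.2)%:R * (unif R (sym_class y (val p).1) t.1 * kappa))).
    rewrite big_mkcond; apply: ler_sum => -[u v] _ /=.
    case: ifPn => [uvE|_]; last by rewrite !mulr_ge0 ?unif_ge0.
    rewrite /F/=; have [_|uv] := eqVneq u v.
      rewrite mul1r ler_wpM2l ?unif_ge0//.
      exact: le_trans (unif_le _ _ _) (yk _).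
    rewrite mul0r /unif; move: uvE; rewrite !inE.
    case: (y u =P _) => [yu|_ _]; last by rewrite !mul0r.
    case: (y v =P _) => [yv|_ _]; last by rewrite mul0r mulr0.
    by move=> /existsP[]; exists u; apply/existsP; exists v; rewrite uv yu yv !eqxx.
  rewrite -(pair_bigA _ (fun u v =>
    (u == v)%:R * (unif R (sym_class y (val p).1) u * kappa)))/=.
  have one u : \sum_(v : 'I_n) (u == v)%:R = 1 :> R.
    rewrite (bigD1 u)//= eqxx big1 ?addr0// => v /negbTE.
    by rewrite eq_sym => ->.
  under eq_bigr do rewrite -mulr_suml one mul1r.
  by rewrite -mulr_suml -[leRHS]mul1r ler_wpM2r// sum_unif lern1 leq_b1.
apply: (@le_trans _ _ (\sum_(e | (p, e) \in A) 2 * kappa ^+ 2)).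
  apply: ler_sum => e eA.
  have : (p, e) \in all_edges y by exact: (fintype.subsetP AE).
  rewrite inE => /edge_massE ->; rewrite expr2 ler_pM ?mulr_ge0 ?invr_ge0//.
    by rewrite -[leRHS]/(1 + 1) lerD2l lern1 leq_b1.
  by rewrite ler_pM ?invr_ge0.
rewrite sumr_const -[leLHS]mulr_natl mulrA [_ * 2]mulrC ler_wpM2r ?exprn_ge0//.
rewrite ler_wpM2l// ler_nat (leq_trans _ AN)//.
rewrite -(card_imset _ (f := fun e => (p, e))); last by move=> e e' [].
by apply: subset_leq_card; apply/fintype.subsetP => _ /imsetP[e eA ->].
Qed.

End EdgeMass.

(** * Finite probability spaces and the total variation distance *)

Local Open Scope classical_set_scope.

(** Each u with Z u <> Z' u contributes at most 2 / n to the sum of differences. *)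
Lemma dTV_empirical_le (R : realType) (Y : finType) n (Z Z' : 'I_n -> nbh Y) :
  (dTV (empirical R Z) (empirical R Z') <=
   (n%:R^-1 * #|[set u | Z u != Z' u]%SET|%:R)%:E)%E.
Proof.
set b := #|_|; rewrite /dTV.
suff : (\esum_(x in [set: nbh Y]) `|empirical R Z x - empirical R Z' x|%:E <=
       (n%:R^-1 * (2 * b%:R))%:E :> \bar R)%E.
  move=> /(@lee_wpmul2l _ (2^-1)%:E); rewrite lee_fin invr_ge0 ler0n => /(_ isT).
  move=> /le_trans; apply; rewrite -EFinM lee_fin mulrCA (mulrA 2^-1).
  by rewrite mulVf ?mul1r.
apply: ge_ereal_sup => _ [A [finA _] <-].
rewrite fsbig_finite//= sumEFin lee_fin.
set s := finmap.enum_fset (fset_set A).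
have us : uniq s by exact: finmap.fset_uniq.
apply: (@le_trans _ _ (\sum_(x <- s)
    n%:R^-1 * \sum_(u < n) `|(Z u == x)%:R - (Z' u == x)%:R|)).
  apply: ler_sum => x _; rewrite /empirical -mulrBr normrM ger0_norm ?invr_ge0//.
  by rewrite ler_wpM2l ?invr_ge0// -sumrB ler_norm_sum.
rewrite -mulr_sumr ler_wpM2l ?invr_ge0// exchange_big/=.
have -> : 2 * b%:R = \sum_(u < n) 2 * (Z u != Z' u)%:R :> R.
  rewrite -mulr_sumr -natr_sum /b -sum1_card big_mkcond/=.
  by congr (_ * _%:R); apply: eq_bigr => u _; rewrite inE; case: eqP.
apply: ler_sum => u _.
case: (eqVneq (Z u) (Z' u)) => [->|_]; rewrite ?mulr0 ?mulr1.
  by rewrite big1// => x _; rewrite subrr normr0.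
apply: (@le_trans _ _ (\sum_(x <- s) ((Z u == x)%:R + (Z' u == x)%:R))).
  apply: ler_sum => x _; rewrite (le_trans (ler_normB _ _))//.
  by rewrite !ger0_norm.
have one a : \sum_(x <- s) (a == x)%:R <= 1 :> R.
  have -> : \sum_(x <- s) (a == x)%:R = (count (pred1 a) s)%:R :> R.
    rewrite -sum1_count [in RHS]big_mkcond natr_sum; apply: eq_bigr => x _ /=.
    by rewrite eq_sym; case: eqP.
  by rewrite count_uniq_mem// lern1 leq_b1.
by rewrite big_split/= (le_trans (lerD (one _) (one _))).
Qed.

Section FiniteProbability.
Variables (R : realType) (C : finType) (m : C -> R).
Hypotheses (m_ge0 : forall c, 0 <= m c) (m1 : \sum_c m c = 1).

Let weight (k : nat) : {nonneg R} :=
  if insub k is Some i then NngNum (m_ge0 (enum_val (A := C) i)) else 0%:nng.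
Let atom (k : nat) : nat :=
  if insub k is Some i then pickle (enum_val (A := C) i) else 0%N.

Let fin_prob : set nat -> \bar R :=
  msum (fun k => mscale (weight k) (dirac (atom k))) #|C|.

HB.instance Definition _ := Measure.on fin_prob.

Let fin_probE (B : set nat) :
  fin_prob B = (\sum_(c | `[< B (pickle c) >]) m c)%:E.
Proof.
rewrite /fin_prob /msum /mscale/= [in RHS]big_mkcond/= (reindex (enum_val (A := C))) /=.
  rewrite -sumEFin.
  apply: eq_bigr => k _; rewrite /mscale /weight /atom valK/= diracE.
  case: asboolP => Bk; first by rewrite mem_set// mule1.
  by rewrite memNset// mule0.
exact: onW_bij (@enum_val_bij C).
Qed.

Let fin_prob_setT : fin_prob [set: nat] = 1%E.
Proof.
rewrite fin_probE (eq_bigl xpredT) ?m1// => c.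
by apply/asboolP.
Qed.

HB.instance Definition _ :=
  @Measure_isProbability.Build _ _ R fin_prob fin_prob_setT.

(** A finite law is carried by nat, where all sets are measurable, through the
    encoding [pickle]. *)
Lemma exists_discrete_probability : exists P : probability nat R,
  forall B : set nat, P B = (\sum_(c | `[< B (pickle c) >]) m c)%:E.
Proof. by exists fin_prob; exact: fin_probE. Qed.

End FiniteProbability.

(** * The coupling of the two models *)

Section CouplingLaw.
Variables (R : realType) (Y : finType) (n : nat) (nu : Y -> R) (pi : Y -> Y -> R).
Variable h : slot n pi * bool -> Defs.ball n pi.
Hypotheses (hbij : bijective h)
  (hE : forall s x, tag (h (s, x)) = slot_dir (tag s) x).

Let bin (y : {ffun 'I_n -> Y}) (k : Defs.ball n pi) : {set 'I_n} :=
  [set v | y v == (tag k).2]%SET.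

Let comps (y : {ffun 'I_n -> Y}) w : upair Y -> {set {set {set 'I_n}}} :=
  completions (fun s : slot n pi => tag s) (class_edges y) (class_size n pi)
    (slot_edge h w).

(** The edges given by the slots are independent with law [edge_mass]. The balls are
    regrouped by slots, and then the ordered pairs of bins by the edge they
    give. *)
Lemma sum_prod_bin (y : {ffun 'I_n -> Y}) (F : {ffun slot n pi -> {set 'I_n}} -> R) :
  \sum_(w : {ffun Defs.ball n pi -> 'I_n})
    (\prod_k unif R (bin y k) (w k)) * F (slot_edge h w) =
  \sum_(g : {ffun slot n pi -> {set 'I_n}})
    (\prod_s edge_mass R y (tag s) (g s)) * F g.
Proof.
have [hi hK Kh] := hbij.
pose W (f : {ffun slot n pi -> 'I_n * 'I_n}) : {ffun Defs.ball n pi -> 'I_n} :=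
  [ffun k => if (hi k).2 then (f (hi k).1).2 else (f (hi k).1).1].
rewrite (reindex W)/=; last first.
  exists (fun w : {ffun Defs.ball n pi -> 'I_n} =>
      [ffun s => (w (h (s, false)), w (h (s, true)))]) => [f|w] _.
    by apply/ffunP => s; rewrite !ffunE !hK /=; case: (f s).
  apply/ffunP => k; rewrite !ffunE -[in RHS](Kh k).
  by case: (hi k) => s [].
pose c (f : {ffun slot n pi -> 'I_n * 'I_n}) : {ffun slot n pi -> {set 'I_n}} :=
  [ffun s => [set (f s).1; (f s).2]%SET].
pose G (s : slot n pi) (t : 'I_n * 'I_n) :=
  unif R (sym_class y (val (tag s)).1) t.1 * unif R (sym_class y (val (tag s)).2) t.2.
transitivity (\sum_(f : {ffun slot n pi -> 'I_n * 'I_n}) (\prod_s G s (f s)) * F (c f)).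
  apply: eq_bigr => f _; congr (_ * F _); last first.
    by apply/ffunP => s; rewrite !ffunE !hK.
  rewrite (reindex h)/=; last exact: onW_bij.
  rewrite (eq_bigr (fun i => unif R (bin y (h (i.1, i.2))) (W f (h (i.1, i.2)))));
    last by move=> [].
  rewrite -(pair_bigA _ (fun s x => unif R (bin y (h (s, x))) (W f (h (s, x)))))/=.
  apply: eq_bigr => s _; rewrite big_bool/= mulrC !ffunE !hK /=.
  by rewrite /G /bin !hE.
rewrite (partition_big c xpredT)//=; apply: eq_bigr => g _.
under eq_bigr => f /eqP -> do [].
rewrite -mulr_suml; congr (_ * _).
rewrite /edge_mass bigA_distr_big_dep/=.
apply: eq_bigl => f; apply/eqP/familyP => [fg s|fg].
  by rewrite unfold_in /= -fg ffunE.
by apply/ffunP => s; rewrite ffunE; have := fg s; rewrite unfold_in => /eqP.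
Qed.

(** Symbols, bins of the balls and edge sets: given the symbols and the balls, the
    edge set for each unordered pair is a uniform completion of the edges given by
    its slots. *)
Definition coupling_mass
   (x : {ffun 'I_n -> Y} * ({ffun Defs.ball n pi -> 'I_n} *
     {ffun upair Y -> {set {set 'I_n}}})) : R :=
  symbol_mass nu x.1 * ((\prod_k unif R (bin x.1 k) (x.2.1 k)) *
    \prod_p unif R (comps x.1 x.2.1 p) (x.2.2 p)).

Lemma coupling_mass_ge0 x : 0 <= coupling_mass x.
Proof.
by rewrite !mulr_ge0 ?unif_ge0// prodr_ge0// => i _; rewrite unif_ge0.
Qed.

Hypothesis alloc1 : alloc_law n nu pi setT = 1%E.
Hypothesis graph1 : graph_law n nu pi setT = 1%E.

Let arr_neq0 : arrangements n nu != finset.set0.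
Proof.
move: alloc1 => [].
under eq_bigl do rewrite asboolT//.
by move=> /(total_mass1P R (arrangements n nu) bin) [].
Qed.

Let bin_neq0 y k : y \in arrangements n nu -> bin y k != finset.set0.
Proof.
move: alloc1 => [].
under eq_bigl do rewrite asboolT//.
by move=> /(total_mass1P R (arrangements n nu) bin)[_ +] yA => /(_ y yA); apply.
Qed.

Let draws_neq0 y p : y \in arrangements n nu ->
  draws (class_edges y) (class_size n pi) p != finset.set0.
Proof.
move: graph1 => [].
under eq_bigl do rewrite asboolT//.
move=> /(total_mass1P R (arrangements n nu) (edge_draws pi))[_ +] yA.
by move=> /(_ y yA); apply.
Qed.

Let card_slot_le p : (#|[set s : slot n pi | tag s == p]%SET| <= class_size n pi p)%N.
Proof. by rewrite cardsE (card_tag_fibre (class_size n pi)). Qed.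

Let comps_neq0 y w p : y \in arrangements n nu -> comps y w p != finset.set0.
Proof.
by move=> yA; apply: completions_neq0; [exact: card_slot_le|exact: draws_neq0].
Qed.

(** The completions are drawn from nonempty sets, so that summing them out leaves
    the allocation model. *)
Lemma coupling_mass_alloc
    (F : {ffun 'I_n -> Y} * {ffun Defs.ball n pi -> 'I_n} -> R) :
  \sum_x coupling_mass x * F (x.1, x.2.1) = \sum_w alloc_mass nu w * F w.
Proof.
rewrite [LHS]sum_pair [RHS]sum_pair; apply: eq_bigr => y _.
rewrite [LHS]sum_pair/=.
apply: eq_bigr => w _; rewrite -mulr_suml; congr (_ * _).
rewrite /coupling_mass /alloc_mass/= -!mulr_sumr sum_prod_unif.
have [yA|yA] := boolP (y \in arrangements n nu); last first.
  by rewrite /symbol_mass unif_out ?mul0r.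
rewrite (_ : [forall i, _]) ?mulr1//.
by apply/forallP => p; exact: comps_neq0.
Qed.

Lemma edge_mass_slot1 y (s : slot n pi) : y \in arrangements n nu ->
  \sum_e edge_mass R y (tag s) e = 1.
Proof.
move=> yA; rewrite sum_edge_mass !sum_unif.
have := bin_neq0 (h (s, false)) yA; have := bin_neq0 (h (s, true)) yA.
by rewrite /bin !hE /= => -> ->; rewrite mulr1.
Qed.

(** Summing out the balls leaves uniform edge sets, by
    [sum_mul_unif_completions]. *)
Lemma coupling_mass_graph
    (F : {ffun 'I_n -> Y} * {ffun upair Y -> {set {set 'I_n}}} -> R) :
  \sum_x coupling_mass x * F (x.1, x.2.2) = \sum_w graph_mass nu pi w * F w.
Proof.
rewrite [LHS]sum_pair [RHS]sum_pair; apply: eq_bigr => y _.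
rewrite [LHS]sum_pair/= exchange_big/=.
apply: eq_bigr => D _; rewrite -mulr_suml; congr (_ * _).
rewrite /coupling_mass /graph_mass/= -mulr_sumr.
have [yA|yA] := boolP (y \in arrangements n nu); last first.
  by rewrite /symbol_mass unif_out ?mul0r.
congr (_ * _).
rewrite (sum_prod_bin y (fun g => \prod_p unif R
  (completions (fun s : slot n pi => tag s) (class_edges y) (class_size n pi) g p)
  (D p))).
rewrite (sum_mul_unif_completions _ (@edge_massE R Y n y))//.
- by move=> s; exact: edge_mass_slot1.
- by move=> p; exact: draws_neq0.
Qed.

Lemma coupling_mass1 : \sum_x coupling_mass x = 1.
Proof.
have := coupling_mass_alloc (fun=> 1).
under eq_bigr do rewrite mulr1; move=> ->.
under eq_bigr do rewrite mulr1.
move: alloc1 => [].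
by under eq_bigl do rewrite asboolT//.
Qed.

(** The bound of [redundancy_mgf] holds for every arrangement of the symbols, since
    the class sizes do not depend on the arrangement. *)
Lemma alloc_redundancy_mgf (kappa z : R) :
  (forall a, (num_sym n nu a)%:R^-1 <= kappa) -> 1 <= z ->
  \sum_w alloc_mass nu w *
    z ^+ (#|slot n pi| - #|all_hits w.1 (slot_edge h w.2)|) <=
  (1 + z * (kappa + 2 * #|slot n pi|%:R * kappa ^+ 2)) ^+ #|slot n pi|.
Proof.
move=> kN z1; set bound := leRHS.
rewrite [leLHS]sum_pair/=.
have [y0 y0A] := set0Pn _ arr_neq0.
rewrite -[leRHS]mul1r -(sum_unif1 R y0A) mulr_suml; apply: ler_sum => y _.
rewrite /alloc_mass/=; under eq_bigr do rewrite -mulrA.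
rewrite -mulr_sumr.
have [yA|yA] := boolP (y \in arrangements n nu); last first.
  by rewrite /symbol_mass unif_out ?mul0r.
rewrite ler_wpM2l ?unif_ge0//.
have yk a : #|sym_class y a|%:R^-1 <= kappa.
  move: yA; rewrite inE => /forallP/(_ a)/eqP cE.
  by rewrite (_ : #|sym_class y a| = num_sym n nu a).
rewrite (sum_prod_bin y (fun g => z ^+ (#|slot n pi| - #|all_hits y g|))).
apply: (@redundancy_mgf R _ _ _ (fun s : slot n pi => edge_mass R y (tag s)) _ _
  (fun s e => (tag s, e)) (all_edges y) z _ z1) => [s e|s|s A AE AI].
- exact: edge_mass_ge0.
- exact: edge_mass_slot1.
- exact: edge_mass_bound.
Qed.

End CouplingLaw.

Lemma empirical_coupling_discrepancy (R : realType) (Y : finType) n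
    (nu : Y -> R) (pi : Y -> Y -> R) (h : slot n pi * bool -> Defs.ball n pi) y w D :
  bijective h -> (forall s x, tag (h (s, x)) = slot_dir (tag s) x) ->
  coupling_mass nu h (y, (w, D)) != 0 ->
  (dTV (alloc_empirical (pi := pi) (y, w)) (graph_empirical R (y, D)) <=
   (n%:R^-1 * (4 * (#|slot n pi| - #|all_hits y (slot_edge h w)|)%:R))%:E)%E.
Proof.
move=> hbij hE; rewrite /coupling_mass !mulf_eq0 !negb_or /=.
move=> /and3P[_ /prodf_neq0 w0 /prodf_neq0 D0].
have yw k : y (w k) = (tag k).2.
  apply/eqP; apply: contraNT (w0 k isT) => ywk.
  by rewrite unif_out// inE.
have Dc p : D p \in completions (fun s : slot n pi => tag s) (class_edges y)
    (class_size n pi) (slot_edge h w) p.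
  by apply: contraNT (D0 p isT) => Dp; rewrite unif_out.
apply: (le_trans (dTV_empirical_le _ _ _)).
rewrite lee_fin ler_wpM2l ?invr_ge0// -natrM ler_nat.
apply: leq_trans (card_discrepancy hbij hE yw Dc).
rewrite subset_leq_card//; apply/fintype.subsetP => u; rewrite !inE.
by apply: contraNN => /eqP e; apply/eqP; congr (_, _).
Qed.

(** A coupling with an explicit tail bound. Keeping s free is what yields an
    infinite rate: for n large the second factor is bounded, for each s. *)
Definition tail_coupling (R : realType) (Y : finType) n (nu : Y -> R)
    (pi : Y -> Y -> R) (P : probability nat R) (X X' : nat -> nbh Y -> R) : Prop :=
  is_coupling P X X' (alloc_law n nu pi) (graph_law n nu pi) /\
  forall kappa eps s : R,
    (forall a, (num_sym n nu a)%:R^-1 <= kappa) -> 0 <= s ->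
    (P [set k | (eps%:E <= dTV (X k) (X' k))%E] <=
     (expR (- (s * (eps * n%:R / 4))) *
      (1 + expR s * (kappa + 2 * #|slot n pi|%:R * kappa ^+ 2))
        ^+ #|slot n pi|)%:E)%E.

(** Markov's inequality for expR s to the power of the number of redundant slots:
    the distance is at least eps only if at least eps n / 4 slots are redundant. *)
Lemma exists_tail_coupling (R : realType) (Y : finType) n
    (nu : Y -> R) (pi : Y -> Y -> R) :
  (0 < n)%N -> sym_mass_n n pi ->
  alloc_law n nu pi setT = 1%E -> graph_law n nu pi setT = 1%E ->
  exists (P : probability nat R) (X X' : nat -> nbh Y -> R),
    tail_coupling n nu pi P X X'.
Proof.
move=> n0 pi_sym alloc1 graph1.
have [h hbij hE] := exists_ball_pairing pi_sym.
have mass_ge0 := coupling_mass_ge0 nu h.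
have [P PE] := exists_discrete_probability mass_ge0
  (coupling_mass1 h alloc1 graph1).
pose config : finType := ({ffun 'I_n -> Y} * ({ffun Defs.ball n pi -> 'I_n} *
     {ffun upair Y -> {set {set 'I_n}}}))%type.
pose X (k : nat) : nbh Y -> R := if unpickle k is Some x
  then alloc_empirical (pi := pi) ((x : config).1, x.2.1) else fun=> 0.
pose X' (k : nat) : nbh Y -> R := if unpickle k is Some x
  then graph_empirical R ((x : config).1, x.2.2) else fun=> 0.
exists P, X, X'; split; first split => [B //|B|B].
- rewrite PE /alloc_law /law_of; congr (_%:E).
  rewrite [LHS]big_mkcond [RHS]big_mkcond/=.
  transitivity (\sum_(w : alloc_config n pi) alloc_mass nu w *
      (`[< B (alloc_empirical w) >])%:R); last first.
    by apply: eq_bigr => w _; case: ifP; rewrite ?mulr1 ?mulr0.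
  rewrite -(coupling_mass_alloc h graph1
    (fun w => (`[< B (alloc_empirical w) >])%:R)).
  apply: eq_bigr => x _; rewrite /preimage/= /X pickleK.
  by case: ifP; rewrite ?mulr1 ?mulr0.
- rewrite PE /graph_law /law_of; congr (_%:E).
  rewrite [LHS]big_mkcond [RHS]big_mkcond/=.
  transitivity (\sum_(w : graph_config Y n) graph_mass nu pi w *
      (`[< B (graph_empirical R w) >])%:R); last first.
    by apply: eq_bigr => w _; case: ifP; rewrite ?mulr1 ?mulr0.
  rewrite -(coupling_mass_graph hbij hE alloc1 graph1
    (fun w => (`[< B (graph_empirical R w) >])%:R)).
  apply: eq_bigr => x _; rewrite /preimage/= /X' pickleK.
  by case: ifP; rewrite ?mulr1 ?mulr0.
move=> kappa eps s kN s0.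
rewrite PE lee_fin.
have z1 : 1 <= expR s by rewrite -expR0 ler_expR.
apply: le_trans (ler_wpM2l (expR_ge0 _)
  (alloc_redundancy_mgf hbij hE alloc1 kN z1)).
rewrite -(coupling_mass_alloc h graph1
  (fun w => expR s ^+ (#|slot n pi| - #|all_hits w.1 (slot_edge h w.2)|))).
rewrite mulr_sumr big_mkcond/=; apply: ler_sum => -[y [w D]] _ /=.
have rhs0 : 0 <= expR (- (s * (eps * n%:R / 4))) * (coupling_mass nu h (y, (w, D)) *
    expR s ^+ (#|slot n pi| - #|all_hits y (slot_edge h w)|)).
  apply: mulr_ge0; first exact: expR_ge0.
  by apply: mulr_ge0; [exact: mass_ge0|exact/exprn_ge0/expR_ge0].
case: asboolP => //; rewrite /X /X' pickleK /= => epsle.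
have [->|mass_neq0] := eqVneq (coupling_mass nu h (y, (w, D))) 0.
  by rewrite mul0r mulr0.
rewrite mulrCA -[leLHS]mulr1 ler_wpM2l// -expRM_natl -expRD -[leLHS]expR0 ler_expR.
have := le_trans epsle (empirical_coupling_discrepancy hbij hE mass_neq0).
rewrite lee_fin; set b := (_ - _)%N => ineq.
rewrite addrC mulrC -mulrBr mulr_ge0// subr_ge0.
rewrite ler_pdivrMr// mulrC -ler_pdivlMl ?ltr0n//.
by rewrite (mulrC b%:R).
Qed.

(** * Asymptotics *)

(** The symbols are read off from a bijection between the vertices and the pool. *)
Lemma exists_arrangement (R : realType) (Y : finType) n (nu : Y -> R) :
  prob_mass_n n nu -> arrangements n nu != finset.set0.
Proof.
move=> [[_ nu1] nuN].
have sumN : (\sum_a num_sym n nu a)%N = n.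
  apply/eqP; rewrite -(eqr_nat R) /num_sym natr_sum.
  under eq_bigr do rewrite truncnK//.
  by rewrite -mulr_sumr nu1 mulr1.
have cardN : #|{: {a : Y & 'I_(num_sym n nu a)}}| = n.
  rewrite card_tagged sumnE big_map big_enum/= -[RHS]sumN.
  by apply: eq_bigr => a _; rewrite card_ord.
have [c|f bf _] := @exists_fibre_bij 'I_n {a : Y & 'I_(num_sym n nu a)} unit
    (fun=> tt) (fun=> tt).
  case: c; transitivity n; [rewrite -[RHS]card_ord|rewrite -[LHS]cardN];
    by apply: eq_card.
apply/set0Pn; exists [ffun u => tag (f u)]; rewrite inE; apply/forallP => a.
rewrite -[X in _ == X](card_tag_fibre (num_sym n nu) a).
rewrite -(on_card_preimset (f := f) (onW_bij _ bf)).
by apply/eqP; apply: eq_card => u; rewrite !inE ffunE.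
Qed.

(** There are enough potential edges: if those of type p were at most as many as
    the slots, then [edge_mass_bound], applied to the set of all of them, would
    bound the total mass 1 of [edge_mass] by a number below 1. *)
Lemma alloc_graph_laws_total (R : realType) (Y : finType) n
    (nu : Y -> R) (pi : Y -> Y -> R) (kappa : R) :
  prob_mass_n n nu -> sym_mass_n n pi ->
  (forall a, (0 < num_sym n nu a)%N) ->
  (forall a, (num_sym n nu a)%:R^-1 <= kappa) ->
  kappa + 2 * #|slot n pi|%:R * kappa ^+ 2 < 1 ->
  alloc_law n nu pi setT = 1%E /\ graph_law n nu pi setT = 1%E.
Proof.
move=> nuN pi_sym N0 Nk q1.
have arr0 := exists_arrangement nuN.
have classE y a : y \in arrangements n nu -> #|sym_class y a| = num_sym n nu a.
  by rewrite inE => /forallP/(_ a)/eqP.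
have class0 y a : y \in arrangements n nu -> sym_class y a != finset.set0.
  by move=> yA; rewrite -card_gt0 classE.
split; rewrite /alloc_law /graph_law /law_of; congr (_%:E);
  under eq_bigl do rewrite asboolT//.
  apply/(total_mass1P R (arrangements n nu)
    (fun y (k : Defs.ball n pi) => [set v | y v == (tag k).2]%SET)).
  by split=> // y yA k; exact: class0.
apply/(total_mass1P R (arrangements n nu) (edge_draws pi)).
split=> // y yA p.
have mE : (class_size n pi p <= #|class_edges y p|)%N.
  rewrite leqNgt; apply/negP => Elt.
  have mI : (class_size n pi p <= #|slot n pi|)%N.
    by rewrite card_slot (bigD1 p)//= leq_addr.
  pose A := [set x in all_edges y | x.1 == p]%SET.
  have AE : A \subset all_edges y.
    by apply/fintype.subsetP => x; rewrite inE => /andP[].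
  have AI : (#|A| <= #|slot n pi|)%N.
    apply: leq_trans mI; apply: leq_trans (ltnW Elt).
    rewrite -(card_imset (class_edges y p) (f := fun e => (p, e))); last first.
      by move=> e e' [].
    apply: subset_leq_card; apply/fintype.subsetP => -[p' e].
    rewrite inE => /andP[+ /eqP/= pp]; rewrite inE /= pp => eE.
    by apply/imsetP; exists e.
  have yk a : #|sym_class y a|%:R^-1 <= kappa by rewrite classE.
  have := edge_mass_bound p yk AE AI.
  rewrite (eq_bigl xpredT) => [|e]; last first.
    rewrite finset.in_setD [_ \in A]inE /= eqxx andbT.
    by rewrite andNb.
  rewrite sum_edge_mass !sum_unif !class0// mulr1 => /le_lt_trans/(_ q1).
  by rewrite ltxx.
have [|D [_ DE Dm]] :=
    exists_between_card (finset.sub0set (class_edges y p)) (m := class_size n pi p).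
  by rewrite cards0.
by apply/set0Pn; exists D; rewrite inE DE Dm eqxx.
Qed.

Lemma card_slot_le_balls (R : realType) (Y : finType) n (pi : Y -> Y -> R) :
  sym_mass_n n pi -> (#|slot n pi|%:R <= n%:R * \sum_p pi p.1 p.2 :> R).
Proof.
move=> pi_sym; have [h hb _] := exists_ball_pairing pi_sym.
have [[pi0 _] _] := pi_sym.
apply: (@le_trans _ _ (#|Defs.ball n pi|%:R)).
  rewrite ler_nat -(bij_eq_card hb) card_prod card_bool.
  by rewrite muln2 -addnn leq_addr.
rewrite card_tagged sumnE big_map big_enum/= natr_sum mulr_sumr.
apply: ler_sum => p _; rewrite card_ord truncn_le.
by rewrite mulr_ge0.
Qed.

Unset Implicit Arguments.

Theorem lemma0p4 (R : realType) (Y : finType)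
    (nu_ : nat -> Y -> R) (pi_ : nat -> Y -> Y -> R)
    (nu : Y -> R) (pi : Y -> Y -> R)
    (nu_n : forall n, (0 < n)%N -> prob_mass_n n (nu_ n))
    (pi_n : forall n, (0 < n)%N -> sym_mass_n n (pi_ n))
    (nu_prob : prob_mass nu) (pi_sym : sym_mass pi)
    (nu_cvg : forall a, nu_ n a @[n --> \oo] --> nu a)
    (pi_cvg : forall a b, pi_ n a b @[n --> \oo] --> pi a b)
    (nu_gt0 : forall a, 0 < nu a) :
  exponentially_equivalent
    (fun n => alloc_law n (nu_ n) (pi_ n))
    (fun n => graph_law n (nu_ n) (pi_ n)).
Proof.
pose K : R := \sum_a 2 / nu a.
pose C : R := \sum_(p : Y * Y) (pi p.1 p.2 + 1).
pose L : R := K + 2 * C * K ^+ 2.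
(* eventually every class has at least n / K vertices and there are at most C n
   slots, so that a slot is redundant with probability at most L / n *)
pose good n := [/\ (0 < n)%N,
    forall a, (0 < num_sym n (nu_ n) a)%N,
    forall a, (num_sym n (nu_ n) a)%:R^-1 <= K / n%:R &
    #|slot n (pi_ n)|%:R <= C * n%:R].
have K_ge a : 2 / nu a <= K.
  rewrite /K (bigD1 a)//= lerDl; apply: sumr_ge0 => b _.
  by rewrite divr_ge0// ltW.
have K0 : 0 <= K by apply: sumr_ge0 => a _; rewrite divr_ge0// ltW.
have C0 : 0 <= C by apply: sumr_ge0 => p _; rewrite addr_ge0//; case: pi_sym.
have L0 : 0 <= L by rewrite addr_ge0// !mulr_ge0// exprn_ge0.
have nu_near : \forall n \near \oo, forall a, nu a / 2 < nu_ n a.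
  apply: filter_forall => a; apply: (cvgr_gt (nu a)) => //.
  by rewrite ltr_pdivrMr// ltr_pMr// ltr1n.
have pi_near : \forall n \near \oo, forall p : Y * Y, pi_ n p.1 p.2 < pi p.1 p.2 + 1.
  by apply: filter_forall => p; apply: (cvgr_lt (pi p.1 p.2)) => //; rewrite ltrDl.
have good_near : \forall n \near \oo, good n.
  near=> n.
  have n0 : (0 < n)%N by near: n; exact: nbhs_infty_gt.
  have nR : 0 < n%:R :> R by rewrite ltr0n.
  have [[nu0 _] nuN] := nu_n n n0.
  have sym_ge a : n%:R * (nu a / 2) <= (num_sym n (nu_ n) a)%:R.
    rewrite /num_sym truncnK// ler_wpM2l//; apply: ltW; move: a.
    by near: n.
  have sym0 a : 0 < n%:R * (nu a / 2) by rewrite mulr_gt0// divr_gt0.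
  split=> // [a|a|].
  - by rewrite -(ltr_nat R) (lt_le_trans (sym0 a)).
  - apply: (@le_trans _ _ (n%:R * (nu a / 2))^-1).
      by rewrite lef_pV2 ?posrE// (lt_le_trans (sym0 a)).
    by rewrite invfM invf_div mulrC ler_wpM2r// invr_ge0.
  - apply: (le_trans (card_slot_le_balls (pi_n n n0))).
    rewrite mulrC ler_wpM2r//; apply: ler_sum => p _; apply: ltW; move: p.
    by near: n.
have q_le n : good n ->
    K / n%:R + 2 * #|slot n (pi_ n)|%:R * (K / n%:R) ^+ 2 <= L / n%:R.
  move=> [n0 _ _ slotC]; have nR : 0 < n%:R :> R by rewrite ltr0n.
  rewrite /L [leRHS]mulrDl lerD2l.
  have -> : 2 * C * K ^+ 2 / n%:R = 2 * (C * n%:R) * (K / n%:R) ^+ 2.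
    by field; rewrite gt_eqF.
  by rewrite ler_wpM2r ?exprn_ge0 ?divr_ge0// ler_wpM2l.
have total : \forall n \near \oo,
    alloc_law n (nu_ n) (pi_ n) setT = 1%E /\
    graph_law n (nu_ n) (pi_ n) setT = 1%E.
  near=> n.
  have gn : good n by near: n.
  have [n0 N0 Nk _] := gn.
  apply: (@alloc_graph_laws_total _ _ _ _ _ (K / n%:R)) => //.
  - exact: nu_n.
  - exact: pi_n.
  apply: le_lt_trans (q_le n gn) _.
  rewrite ltr_pdivrMr ?ltr0n// mul1r.
  by near: n; exact: nbhs_infty_gtr.
split=> //.
(* where one of the laws is not a probability law, any space does *)
have coupled n : exists t : probability nat R *
      ((nat -> nbh Y -> R) * (nat -> nbh Y -> R)),
    (0 < n)%N -> alloc_law n (nu_ n) (pi_ n) setT = 1%E ->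
    graph_law n (nu_ n) (pi_ n) setT = 1%E ->
    tail_coupling n (nu_ n) (pi_ n) t.1 t.2.1 t.2.2.
  have [[n0 [alloc1 graph1]]|bad] := pselect ((0 < n)%N /\
      alloc_law n (nu_ n) (pi_ n) setT = 1%E /\
      graph_law n (nu_ n) (pi_ n) setT = 1%E).
    have [P [X [X' PXX']]] := exists_tail_coupling n0 (pi_n n n0) alloc1 graph1.
    by exists (P, (X, X')).
  exists ((\d_0%N : probability nat R), (fun=> fun=> 0, fun=> fun=> 0)).
  by move=> n0 alloc1 graph1; case: bad.
have [t tP] := choice coupled.
exists (fun=> default_measure_display), (fun=> nat),
  (fun n => (t n).1), (fun n => (t n).2.1), (fun n => (t n).2.2).
split=> [n n0 alloc1 graph1|eps eps0]; first by have [] := tP n n0 alloc1 graph1.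
apply/cvgeNyPle => M.
(* s eps / 4 = |M| + 1: one unit more than M asks for absorbs the bounded factor *)
pose s := (`|M| + 1) * 4 / eps.
have s0 : 0 <= s by rewrite divr_ge0 ?mulr_ge0 ?addr_ge0// ltW.
near=> n.
have gn : good n by near: n.
have [n0 N0 Nk slotC] := gn.
have nR : 0 < n%:R :> R by rewrite ltr0n.
have [alloc1 graph1] : alloc_law n (nu_ n) (pi_ n) setT = 1%E /\
  graph_law n (nu_ n) (pi_ n) setT = 1%E by near: n.
have [_ /(_ (K / n%:R) eps s Nk s0) tail] := tP n n0 alloc1 graph1.
have {}tail : ((t n).1 [set k | (eps%:E <= dTV ((t n).2.1 k) ((t n).2.2 k))%E] <=
    (expR (n%:R * (- (`|M| + 1)) + expR s * L * C))%:E)%E.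
  apply: (le_trans tail); rewrite lee_fin expRD ler_pM ?expR_ge0//.
  - rewrite exprn_ge0// addr_ge0// mulr_ge0 ?expR_ge0// addr_ge0 ?divr_ge0//.
    by rewrite !mulr_ge0// exprn_ge0// divr_ge0.
  - rewrite ler_expR le_eqVlt; apply/orP; left; apply/eqP.
    by rewrite /s; field; rewrite gt_eqF.
  apply: (@le_trans _ _ ((expR (expR s * (L / n%:R))) ^+ #|slot n (pi_ n)|)).
    rewrite lerXn2r ?nnegrE ?expR_ge0//.
      rewrite addr_ge0// mulr_ge0 ?expR_ge0// addr_ge0 ?divr_ge0//.
      by rewrite !mulr_ge0// exprn_ge0// divr_ge0.
    apply: le_trans (expR_ge1Dx _); rewrite lerD2l ler_wpM2l ?expR_ge0//.
    exact: q_le.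
  rewrite -expRM_natl ler_expR.
  apply: (@le_trans _ _ (C * n%:R * (expR s * (L / n%:R)))).
    by rewrite ler_wpM2r// mulr_ge0 ?expR_ge0// divr_ge0.
  rewrite le_eqVlt; apply/orP; left; apply/eqP.
  by field; rewrite gt_eqF.
apply: (@le_trans _ _ (n%:R^-1%:E *
    lne (expR (n%:R * (- (`|M| + 1)) + expR s * L * C))%:E)%E).
  rewrite lee_wpmul2l ?lee_fin ?invr_ge0//.
  by rewrite lee_lne// in_itv/= ?measure_ge0 ?leey ?lee_fin ?expR_ge0//.
rewrite lne_EFin ?expR_gt0// expRK -EFinM lee_fin mulrDr mulrA mulVf ?gt_eqF// mul1r.
have : n%:R^-1 * (expR s * L * C) <= 1.
  rewrite ler_pdivrMl// mulr1; apply: ltW.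
  by near: n; exact: nbhs_infty_gtr.
have := ler_norm (- M); rewrite normrN; lra.
Unshelve. all: by end_near.
Qed.
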